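(* Let $d\ge2$ and $q\ge1$. There are at most countably many $p\in[0,1]$ such that $\bar\mu^1_p\neq\bar\mu^0_p$.
   Context: For a finite connected (multi)graph $H$ with conductances $c$, $\Delta^H_cf(x)=\sum_{e=\{x,y\}}c_e(f(x)-f(y))$ acting on zero-sum functions on $\mathbf V(H)$, determinant $\det\Delta^H_c$. $\mathbb P^{H,p}(\kappa)\propto p^{h(\kappa)}(1-p)^{s(\kappa)}(\det\Delta^H_\kappa)^{-1/2}$ on $\{1,q\}^{\mathbf E(H)}$, $h,s$ counting edges with $\kappa_e=q$, resp. $1$. $\Lambda_n=[-n,n]^d\cap\mathbb Z^d$, $E_n$ its internal nearest-neighbour edges, $\partial\Lambda_n$ the vertices of $\Lambda_n$ with a neighbour outside, $\Lambda_n^w$ the multigraph from $(\Lambda_n,E_n)$ by identifying $\partial\Lambda_n$ to one vertex. $\bar\mu^0_p$, $\bar\mu^1_p$ are the limits as $n\to\infty$ (which exist, in the sense of convergence of probabilities of events depending on finitely many edges) of $\mathbb P^{\Lambda_n,p}$ and $\mathbb P^{\Lambda_n^w,p}$, respectively, as measures on $\{1,q\}^{\mathbf E(\mathbb Z^d)}$. *)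

(* Defs.v *)
From Stdlib Require Import Reals ZArith Arith List Bool.
Import ListNotations.
Open Scope R_scope.

Definition sumR (n : nat) (f : nat -> R) : R :=
  fold_right Rplus 0 (map f (seq 0 n)).

Fixpoint det (n : nat) (M : nat -> nat -> R) : R :=
  match n with
  | O => 1
  | S k => sumR (S k) (fun j =>
             (-1) ^ j * M O j *
             det k (fun a b => M (S a) (if Nat.ltb b j then b else S b)))
  end.

(* A multigraph on vertices 0..N-1 given by a list of edges (endpoint pairs);
   conductances are given by a list c aligned with the edge list. *)

Definition delta (x y : nat) : R := if Nat.eqb x y then 1 else 0.

Definition lapl_entry (E : list (nat * nat)) (c : list R) (x y : nat) : R :=
  fold_right Rplus 0
    (map (fun ec : (nat * nat) * R =>
            let '((a, b), ce) := ec in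
            delta x a * ce * (delta y a - delta y b)
            + delta x b * ce * (delta y b - delta y a))
         (combine E c)).

(* Determinant of Delta_c acting on zero-sum functions on {0..N-1}:
   matrix of the operator in the basis (delta_i - delta_{N-1})_{i < N-1}
   of the zero-sum subspace (a zero-sum v has coordinates v_0..v_{N-2}). *)
Definition det_lapl (N : nat) (E : list (nat * nat)) (c : list R) : R :=
  det (N - 1) (fun j i => lapl_entry E c j i - lapl_entry E c j (N - 1)).

Fixpoint all_configs (m : nat) : list (list bool) :=
  match m with
  | O => [nil]
  | S k => flat_map (fun l => [true :: l; false :: l]) (all_configs k)
  end.

Definition cond_of (q : R) (kappa : list bool) : list R :=
  map (fun b : bool => if b then q else 1%R) kappa.

Definition weight (N : nat) (E : list (nat * nat)) (p q : R) (kappa : list bool) : R :=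
  p ^ (count_occ Bool.bool_dec kappa true)
  * (1 - p) ^ (count_occ Bool.bool_dec kappa false)
  / sqrt (det_lapl N E (cond_of q kappa)).

Definition prob (N : nat) (E : list (nat * nat)) (p q : R)
    (ev : list bool -> bool) : R :=
  fold_right Rplus 0 (map (fun k => if ev k then weight N E p q k else 0)
                         (all_configs (length E)))
  / fold_right Rplus 0 (map (weight N E p q) (all_configs (length E))).

Definition point := list Z.        (* points of Z^d: lists of length d *)
Definition zedge := (point * nat)%type.
(* the nearest-neighbour edge (x, i) is {x, x + e_i} *)

Definition point_eqb (x y : point) : bool :=
  if list_eq_dec Z.eq_dec x y then true else false.

Fixpoint shift (x : point) (i : nat) : point :=
  match x, i with
  | [], _ => []
  | z :: x', O => (z + 1)%Z :: x'
  | z :: x', S i' => z :: shift x' i'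
  end.

Definition zrange (n : nat) : list Z :=
  map (fun k => (Z.of_nat k - Z.of_nat n)%Z) (seq 0 (2 * n + 1)).

Fixpoint box (d n : nat) : list point :=
  match d with
  | O => [(nil : point)]
  | S d' => flat_map (fun z => map (cons z) (box d' n)) (zrange n)
  end.

Definition in_box (n : nat) (x : point) : bool :=
  forallb (fun z => Z.leb (Z.abs z) (Z.of_nat n)) x.

(* x in Lambda_n has a neighbour outside Lambda_n *)
Definition on_boundary (n : nat) (x : point) : bool :=
  existsb (fun z => Z.eqb (Z.abs z) (Z.of_nat n)) x.

Definition box_edges (d n : nat) : list zedge :=
  flat_map (fun x =>
     map (fun i => (x, i))
         (filter (fun i => in_box n (shift x i)) (seq 0 d)))
    (box d n).

Fixpoint pos (x : point) (l : list point) : nat :=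
  match l with
  | [] => O
  | y :: l' => if point_eqb x y then O else S (pos x l')
  end.

Definition free_N (d n : nat) : nat := length (box d n).
Definition free_E (d n : nat) : list (nat * nat) :=
  map (fun e : zedge => (pos (fst e) (box d n), pos (shift (fst e) (snd e)) (box d n)))
      (box_edges d n).

Definition interior (d n : nat) : list point :=
  filter (fun x => negb (on_boundary n x)) (box d n).
Definition wired_index (d n : nat) (x : point) : nat :=
  if on_boundary n x then O else S (pos x (interior d n)).
Definition wired_N (d n : nat) : nat := S (length (interior d n)).
Definition wired_E (d n : nat) : list (nat * nat) :=
  map (fun e : zedge => (wired_index d n (fst e), wired_index d n (shift (fst e) (snd e))))
      (box_edges d n).

(* an event depending on the finitely many edges F of Z^d: a predicate A on
   the values (true <-> q) of kappa on F.  In finite volume, edges of F not in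
   E_n are read as false (irrelevant for n large). *)
Fixpoint lookup (e : zedge) (Es : list zedge) (k : list bool) : bool :=
  match Es, k with
  | e' :: Es', b :: k' =>
      if point_eqb (fst e) (fst e') && Nat.eqb (snd e) (snd e') then b
      else lookup e Es' k'
  | _, _ => false
  end.

Definition restrict_event (d n : nat) (F : list zedge) (A : list bool -> bool)
  : list bool -> bool :=
  fun k => A (map (fun e => lookup e (box_edges d n) k) F).

Definition P_free (d : nat) (q p : R) (F : list zedge) (A : list bool -> bool)
    (n : nat) : R :=
  prob (free_N d n) (free_E d n) p q (restrict_event d n F A).
Definition P_wired (d : nat) (q p : R) (F : list zedge) (A : list bool -> bool)
    (n : nat) : R :=
  prob (wired_N d n) (wired_E d n) p q (restrict_event d n F A).

Definition mu_differ (d : nat) (q p : R) : Prop :=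
  exists (F : list zedge) (A : list bool -> bool) (l0 l1 : R),
    Un_cv (P_free d q p F A) l0 /\ Un_cv (P_wired d q p F A) l1 /\ l0 <> l1.

(* Main.v *)
(** For p < p', Jensen's inequality bounds the increment of each log-partition function in l = log(p'/(1-p')) - log(p/(1-p)) from below by l times the mean number of q-edges at p and from above by l times that mean at p'. By Rayleigh monotonicity the ratio of the wired to the free determinant is decreasing in the configuration, and by homogeneity its extreme values differ by the factor q^(|boundary| - 1), so free and wired increments agree up to a boundary term. Hence the wired edge density at p is at most the free edge density at p', up to a vanishing error.
    Rayleigh monotonicity also gives the Holley condition for networks related by contraction, so the wired measures dominate the free ones, and edge probabilities are monotone in the domain. If the limits differ at p, then translating a distinguishing edge over the box makes the two densities at p differ by some c > 0 in all large boxes. The free density therefore jumps by at least c at such a p, which leaves finitely many such p for each c. *)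

From Stdlib Require Import Reals ZArith Arith List Bool Lia Lra Permutation Sorted.
From Stdlib Require Import FunctionalExtensionality Classical ClassicalEpsilon Cantor.
From mathcomp Require all_boot all_order all_algebra Rstruct ring zify.
Require Import Defs.
Open Scope R_scope.

(** * Determinant of a weighted Laplacian *)

Module LaplacianDeterminant.
Import all_boot all_order all_algebra Rstruct ring zify.
Import Order.TTheory GRing.Theory Num.Theory.
Local Open Scope ring_scope.

(** Rayleigh monotonicity enters through the potential of a unit current along an edge. Raising that
    edge from 1 to [q] is a rank one perturbation of the Laplacian, so the determinant is multiplied
    by 1 + ([q] - 1) times the effective resistance, and resistances of two networks are compared by
    testing one Dirichlet form against a pulled-back potential. Partition functions of the two boxes
    agree only up to a factor, which says nothing about derivatives at a single [p]. This is why
    Jensen's inequality is used at two parameters. The price is the log-odds gap in the denominator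
    of the boundary term; it is harmless because a finite chain of parameters is fixed before the
    box grows. No limiting density is formed. All jumps of a chain are tested in one large box,
    where the expected number of open edges is at most [d] times the volume while each jump costs
    about [c] times the volume. This leaves at most 1 + 2([d] + 1)/[c] jump points of size [c], and
    [c] runs through the numbers 1/(m + 1). The endpoints 0 and 1, where weights vanish, are added
    by hand. *)

Definition inc (e : nat * nat) (k : nat) : R := (k == e.1)%:R - (k == e.2)%:R.

Definition within (n : nat) (W : seq ((nat * nat) * R)) : Prop :=
  forall w, w \in W -> (w.1.1 < n)%N /\ (w.1.2 < n)%N.

Definition laplacian (W : seq ((nat * nat) * R)) (u : nat -> R) (k : nat) : R :=
  \sum_(w <- W) w.2 * inc w.1 k * (u w.1.1 - u w.1.2).

Definition dirichlet (W : seq ((nat * nat) * R)) (u f : nat -> R) : R :=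
  \sum_(w <- W) w.2 * (u w.1.1 - u w.1.2) * (f w.1.1 - f w.1.2).

(** The vertices are 0..[n], so [n] is both the dimension of the zero-sum space and the index of the
    last vertex; the basis is delta_i - delta_n. *)
Definition lapl_mx (n : nat) (W : seq ((nat * nat) * R)) : 'M[R]_n :=
  \matrix_(j, i) \sum_(w <- W) w.2 * inc w.1 j * (inc w.1 i - inc w.1 n).

(** The zero-sum function with coordinates [u]: minus their total is placed at the last vertex
    [n]. *)
Definition zero_sum_ext (n : nat) (u : 'cV[R]_n) (k : nat) : R :=
  if insub k is Some i then u i 0 else - \sum_i u i 0.

Lemma sum_inc n e (f : nat -> R) : (e.1 < n)%N -> (e.2 < n)%N ->
  \sum_(k < n) f k * inc e k = f e.1 - f e.2.
Proof.
move=> h1 h2.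
have H x : (x < n)%N -> \sum_(k < n) f k * ((k : nat) == x)%:R = f x.
  move=> hx; rewrite (bigD1 (Ordinal hx)) //= eqxx mulr1 big1 ?addr0 // => i.
  by rewrite -val_eqE /= => /negbTE ->; rewrite mulr0.
by rewrite -(H _ h1) -(H _ h2) -sumrB; apply: eq_bigr => i _; rewrite mulrBr.
Qed.

Lemma sum_laplacian n W u (f : nat -> R) : within n W ->
  \sum_(k < n) f k * laplacian W u k = dirichlet W u f.
Proof.
move=> hW; under eq_bigr do rewrite mulr_sumr.
rewrite exchange_big; apply: eq_big_seq => w /hW [h1 h2].
rewrite -(sum_inc _ _ f h1 h2) mulr_sumr.
by apply: eq_bigr => k _; ring.
Qed.

Lemma zero_sum_ext_ord n (u : 'cV[R]_n) (i : 'I_n) : zero_sum_ext n u i = u i 0.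
Proof. by rewrite /zero_sum_ext valK. Qed.

Lemma zero_sum_ext_last n (u : 'cV[R]_n) : zero_sum_ext n u n = - \sum_i u i 0.
Proof. by rewrite /zero_sum_ext insubF ?ltnn. Qed.

Lemma zero_sum_ext_sum n (u : 'cV[R]_n) : \sum_(k < n.+1) zero_sum_ext n u k = 0.
Proof.
rewrite big_ord_recr /= zero_sum_ext_last; apply/eqP; rewrite subr_eq0; apply/eqP.
by apply: eq_bigr => i _; rewrite zero_sum_ext_ord.
Qed.

Lemma inc_diff_mul n e (u : 'cV[R]_n) : (e.1 < n.+1)%N -> (e.2 < n.+1)%N ->
  \sum_(i < n) (inc e i - inc e n) * u i 0 = zero_sum_ext n u e.1 - zero_sum_ext n u e.2.
Proof.
move=> h1 h2; rewrite -(sum_inc _ _ _ h1 h2) big_ord_recr /= zero_sum_ext_last.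
under eq_bigr do rewrite mulrBl.
rewrite sumrB -mulr_sumr; congr (_ + _); last by ring.
by apply: eq_bigr => i _; rewrite zero_sum_ext_ord mulrC.
Qed.

Lemma lapl_mx_mul n W (u : 'cV[R]_n) j : within n.+1 W ->
  (lapl_mx n W *m u) j 0 = laplacian W (zero_sum_ext n u) j.
Proof.
move=> hW; rewrite mxE; under eq_bigr do rewrite mxE mulr_suml.
rewrite exchange_big; apply: eq_big_seq => w /hW [h1 h2].
rewrite -(inc_diff_mul _ _ _ h1 h2) mulr_sumr.
by apply: eq_bigr => k _; ring.
Qed.

(** Matrix identities control only the first [n] coordinates; equal totals recover the last one. *)
Lemma eq_last n (f g : nat -> R) :
  \sum_(k < n.+1) f k = \sum_(k < n.+1) g k ->
  (forall k : 'I_n, f k = g k) -> forall k : 'I_n.+1, f k = g k.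
Proof.
move=> hs h k; case: (ltnP k n) => hk; first exact: (h (Ordinal hk)).
have -> : (k : nat) = n by apply/eqP; rewrite eqn_leq hk -ltnS ltn_ord.
by move: hs; rewrite !big_ord_recr /= (eq_bigr (fun k : 'I_n => g k)) // => /addrI.
Qed.

Lemma laplacian_sum n W u : within n W -> \sum_(k < n) laplacian W u k = 0.
Proof.
move=> hW; have := sum_laplacian n W u (fun=> 1) hW.
under eq_bigr do rewrite mul1r.
by move=> ->; rewrite /dirichlet big1 // => w _; rewrite subrr mulr0.
Qed.

(** Connectedness in the form in which it is used: a function of zero energy is constant along
    edges, hence constant. No paths are needed. *)
Definition connected (n : nat) (W : seq ((nat * nat) * R)) : Prop :=
  forall f : nat -> R, (forall w, w \in W -> f w.1.1 = f w.1.2) ->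
  forall i j, (i < n)%N -> (j < n)%N -> f i = f j.

Definition positive (W : seq ((nat * nat) * R)) : Prop :=
  forall w, w \in W -> 0 < w.2.

Lemma dirichlet_ge0 W f : positive W -> 0 <= dirichlet W f f.
Proof.
move=> hp; rewrite /dirichlet big_seq; apply: sumr_ge0 => w /hp hw.
by rewrite -mulrA; apply: mulr_ge0; [exact: ltW | rewrite -expr2 sqr_ge0].
Qed.

Lemma dirichlet_eq0 W f : positive W -> dirichlet W f f = 0 ->
  forall w, w \in W -> f w.1.1 = f w.1.2.
Proof.
move=> hp /eqP; rewrite /dirichlet big_seq psumr_eq0; last first.
  by move=> w /hp hw; rewrite -mulrA; apply: mulr_ge0; [exact: ltW | rewrite -expr2 sqr_ge0].
move=> /allP h w hw; have := h w hw; rewrite hw /= -mulrA mulf_eq0 gt_eqF ?hp //=.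
by rewrite -expr2 sqrf_eq0 subr_eq0 => /eqP.
Qed.

(* The interpolation between the identity and the Laplacian stays injective, so its determinant keeps the sign it has at the identity. *)
Lemma interp_inj n W (s : R) (u : 'cV[R]_n) :
  within n.+1 W -> positive W -> connected n.+1 W -> 0 <= s <= 1 ->
  ((1 - s)%:M + s *: lapl_mx n W) *m u = 0 -> u = 0.
Proof.
move=> hW hp hc /andP[s0 s1] h.
set z := zero_sum_ext n u.
have H (k : 'I_n.+1) : (1 - s) * z k + s * laplacian W z k = 0.
  apply: (eq_last n (fun k => (1 - s) * z k + s * laplacian W z k) (fun=> 0)).
    by rewrite big_split /= -!mulr_sumr zero_sum_ext_sum laplacian_sum // big1 // !mulr0 addr0.
  move=> {}k; have /matrixP/(_ k 0) := h.
  rewrite mulmxDl mul_scalar_mx -scalemxAl !mxE => <-.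
  by rewrite -(lapl_mx_mul _ _ _ _ hW) /z zero_sum_ext_ord mxE.
(* Pairing with [z] itself gives a vanishing sum of two nonnegative terms, the squared norm weighted
   by 1 - s and the energy weighted by s. If s < 1 the norm vanishes; if s = 1 the energy does, and
   connectedness together with the zero sum forces [z] = 0. *)
have : \sum_(k < n.+1) z k * ((1 - s) * z k + s * laplacian W z k) = 0.
  by rewrite big1 // => k _; rewrite H mulr0.
under eq_bigr do rewrite mulrDr mulrCA [X in _ + X]mulrCA.
rewrite big_split /= -!mulr_sumr sum_laplacian // => E0.
have sq : 0 <= \sum_(k < n.+1) z k * z k.
  by apply: sumr_ge0 => k _; rewrite -expr2 sqr_ge0.
have dg : 0 <= dirichlet W z z by exact: dirichlet_ge0.
have z0 : forall k : 'I_n.+1, z k = 0.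
  have /eqP E1 : (1 - s) * (\sum_(k < n.+1) z k * z k) == 0.
    by rewrite eq_le mulr_ge0 ?subr_ge0 // andbT -[X in _ <= X]E0 lerDl mulr_ge0.
  have /eqP E2 : s * dirichlet W z z == 0 by rewrite -E0 E1 add0r.
  case: (eqVneq s 1) => [es|ns].
    have /(dirichlet_eq0 _ _ hp) zc : dirichlet W z z = 0 by rewrite -E2 es mul1r.
    move=> k; have zk (j : 'I_n.+1) : z j = z k.
      by apply: (hc z) => //; apply: ltn_ord.
    have := zero_sum_ext_sum n u; rewrite -/z.
    under eq_bigr do rewrite zk.
    rewrite sumr_const card_ord => /eqP; rewrite mulrn_eq0 /= => /eqP //.
  move: E1 => /eqP; rewrite mulf_eq0 subr_eq0 eq_sym (negbTE ns) /=.
  rewrite psumr_eq0; last by move=> k _; rewrite -expr2 sqr_ge0.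
  by move=> /allP h0 k; have := h0 k (mem_index_enum _); rewrite /= -expr2 sqrf_eq0 => /eqP.
apply/matrixP => i j; rewrite ord1 mxE -zero_sum_ext_ord.
by have := z0 (widen_ord (leqnSn n) i).
Qed.

Lemma inj_det_neq0 n (A : 'M[R]_n) :
  (forall u : 'cV[R]_n, A *m u = 0 -> u = 0) -> \det A != 0.
Proof.
move=> h; rewrite -det_tr; apply/negP => /det0P [v v0 hv].
have /eqP : v^T = 0.
  by apply: h; apply: trmx_inj; rewrite trmx_mul trmxK hv trmx0.
by rewrite trmx_eq0 (negbTE v0).
Qed.

(** The determinant of the interpolation is a polynomial in s with value 1 at s = 0 and no root in
    [0, 1]; a negative value at s = 1 would contradict the intermediate value theorem. *)
Lemma det_lapl_mx_gt0 n W :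
  within n.+1 W -> positive W -> connected n.+1 W -> 0 < \det (lapl_mx n W).
Proof.
move=> hW hp hc.
pose P : 'M[{poly R}]_n :=
  (1 - 'X)%:M + 'X *: map_mx polyC (lapl_mx n W).
have Pe s : (\det P).[s] = \det ((1 - s)%:M + s *: lapl_mx n W).
  rewrite -[LHS]/(horner_eval s (\det P)) -det_map_mx; congr (\det _).
  apply/matrixP => i j; rewrite !mxE.
  by rewrite /= /horner_eval hornerD hornerMn !hornerE. 
have P1 : (\det P).[1] = \det (lapl_mx n W).
  by rewrite Pe subrr scale1r raddf0 add0r.
have P0 : (\det P).[0] = 1 by rewrite Pe subr0 scale0r addr0 det1.
rewrite lt_neqAle eq_sym -{1}P1 Pe inj_det_neq0 /=; last first.
  by move=> u; apply: interp_inj => //; rewrite ler01 lexx.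
rewrite leNgt; apply/negP => hneg.
have [||x /andP[x0 x1]] := @poly_ivt _ (- \det P) 0 1.
- exact: ler01.
- by rewrite !hornerN P0 P1 oppr_le0 oppr_ge0 ler01 ltW.
rewrite rootN => /rootP rx.
have : \det ((1 - x)%:M + x *: lapl_mx n W) != 0.
  by apply: inj_det_neq0 => u; apply: interp_inj => //; apply/andP.
by rewrite -Pe rx eqxx.
Qed.

(** * Rank one updates and effective resistance *)

(** Matrix determinant lemma: unipotent block factors move the perturbation from the diagonal block
    of size [n] to the one of size 1. *)
Lemma det_rank1 n (u : 'cV[R]_n) (v : 'rV[R]_n) :
  \det (1%:M + u *m v) = 1 + (v *m u) 0 0.
Proof.
have E1 : block_mx 1%:M 0 v 1%:M *m block_mx (1%:M + u *m v) u 0 1%:M *m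
          block_mx 1%:M 0 (- v) 1%:M = block_mx 1%:M u 0 (1%:M + v *m u).
  rewrite !mulmx_block !mul1mx !mul0mx !mulmx1 !mulmx0 !addr0 !add0r.
  rewrite !mulmxN !mulmxDr !mulmxDl !mulmx1 !mul1mx mulmxA addrK.
  by rewrite [v + _]addrC subrr [v *m u + _]addrC.
have := congr1 (fun A => \det A) E1.
rewrite !det_mulmx !det_lblock !det_ublock !det1 !mul1r !mulr1 => ->.
by rewrite det_mx11 !mxE eqxx.
Qed.


Lemma lapl_mx_cat n W1 W2 : lapl_mx n (W1 ++ W2) = lapl_mx n W1 + lapl_mx n W2.
Proof. by apply/matrixP => i j; rewrite !mxE big_cat. Qed.

Lemma lapl_mx_cons n w W : lapl_mx n (w :: W) =
  w.2 *: ((\col_j inc w.1 j) *m (\row_i (inc w.1 i - inc w.1 n))) + lapl_mx n W.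
Proof.
by apply/matrixP => i j; rewrite !mxE big_cons big_ord1 !mxE mulrA.
Qed.

(** Here [u] solves the Laplace equation with a unit source and sink at the ends of [e], so Green's
    identity makes the Dirichlet form against [u] reproduce differences along [e]. A change of the
    conductance of [e] is a rank one perturbation, and [u e.1 - u e.2] is the effective resistance
    across [e]. *)
Lemma resistance_exists n W1 W2 e s :
  let W := W1 ++ (e, s) :: W2 in
  within n.+1 W -> positive W -> connected n.+1 W ->
  exists u : nat -> R, (forall f, f e.1 - f e.2 = dirichlet W u f) /\
    forall s', \det (lapl_mx n (W1 ++ (e, s') :: W2)) =
      \det (lapl_mx n W) * (1 + (s' - s) * (u e.1 - u e.2)).
Proof.
move=> W hW hp hc; set A := lapl_mx n W.
pose b : 'cV[R]_n := \col_j inc e j.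
pose r : 'rV[R]_n := \row_i (inc e i - inc e n).
have uA : A \in unitmx by rewrite unitmxE unitfE gt_eqF // det_lapl_mx_gt0.
have [e1 e2] : (e.1 < n.+1)%N /\ (e.2 < n.+1)%N.
  by apply: (hW (e, s)); rewrite mem_cat inE eqxx orbT.
pose u0 := invmx A *m b; exists (zero_sum_ext n u0); split=> [f|s'].
  rewrite -(sum_laplacian n.+1) // -(sum_inc _ _ _ e1 e2).
  apply: eq_bigr => k _; congr (_ * _); apply: (eq_last n (inc e)).
    rewrite laplacian_sum //; under eq_bigr do rewrite -[inc _ _]mul1r.
    by rewrite (sum_inc _ _ (fun=> 1)) // subrr.
  move=> {}k; rewrite -lapl_mx_mul // -/A /u0 mulmxA mulmxV // mul1mx.
  by rewrite mxE.
have -> : lapl_mx n (W1 ++ (e, s') :: W2) = A *m (1%:M + u0 *m ((s' - s) *: r)).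
  rewrite mulmxDr mulmx1 mulmxA /u0 mulmxA mulmxV // mul1mx -scalemxAr.
  rewrite /A !lapl_mx_cat !lapl_mx_cons /= -/b -/r scalerBl.
  by rewrite -addrA; congr (_ + _); rewrite [RHS]addrC addrA subrK.
rewrite det_mulmx det_rank1 -scalemxAl mxE; congr (_ * (1 + _ * _)).
rewrite -inc_diff_mul // mxE; apply: eq_bigr => i _; by rewrite mxE.
Qed.

Lemma lapl_mx_scale n W t :
  lapl_mx n [seq (w.1, t * w.2) | w <- W] = t *: lapl_mx n W.
Proof.
apply/matrixP => i j; rewrite !mxE big_map mulr_sumr.
by apply: eq_bigr => w _ /=; rewrite !mulrA.
Qed.

(** * Transfer to the determinant of the statement *)

Lemma det_def n (F : nat -> nat -> R) :
  det n F = \det (\matrix_(i < n, j < n) F i j).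
Proof.
elim: n F => [|n IH] F; first by rewrite det_mx00.
have sumRE m (g : nat -> R) : sumR m g = \sum_(j < m) g j.
  rewrite /sumR -(big_mkord xpredT) /index_iota subn0.
  elim: m {1 2}0%N => [|m IHm] k; first by rewrite big_nil.
  by rewrite /= big_cons -IHm.
rewrite (expand_det_row _ ord0) [LHS]sumRE; apply: eq_bigr => j _.
rewrite -/(det n).
rewrite !mxE IH /cofactor /= add0n RpowE !RmultE [_ * F _ _]mulrC -mulrA; congr (_ * (_ * _)).
congr (\det _); apply/matrixP => a b; rewrite !mxE /= /bump.
congr (F _ _); case: (Nat.ltb_spec b j) => h; case: leqP => //; lia.
Qed.

Lemma lapl_entry_sum E c x y : lapl_entry E c x y =
  \sum_(w <- List.combine E c) w.2 * inc w.1 x * inc w.1 y.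
Proof.
have dE a b : delta a b = (a == b)%:R.
  by rewrite /delta; case: (Nat.eqb_spec a b) => [->|/eqP/negbTE ->]; rewrite ?eqxx.
rewrite /lapl_entry; elim: (List.combine E c) => [|[[a b] s] W IH]; first by rewrite big_nil.
rewrite big_cons -IH /= /inc !dE; congr (_ + _) => /=.
rewrite !RplusE !RmultE !RminusE; ring.
Qed.

Lemma det_lapl_eq n E c : det_lapl n.+1 E c = \det (lapl_mx n (List.combine E c)).
Proof.
rewrite /det_lapl Nat.sub_succ Nat.sub_0_r det_def; congr (\det _); apply/matrixP => i j.
rewrite !mxE !lapl_entry_sum RminusE -sumrB.
by apply: eq_bigr => w _; rewrite [RHS]mulrBr.
Qed.

Section Labelled.
Variables (T : Type) (N : nat) (Es : list T) (ends : T -> nat * nat).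

Definition weighted (c : T -> R) (l : list T) : seq ((nat * nat) * R) :=
  [seq (ends e, c e) | e <- l].

Lemma combine_weighted c : List.combine (List.map ends Es) (List.map c Es) = weighted c Es.
Proof. by rewrite /weighted; elim: Es => //= e l ->. Qed.

Lemma mem_weighted c w : w \in weighted c Es -> exists2 e, List.In e Es & w = (ends e, c e).
Proof.
rewrite /weighted; elim: Es => //= e l IH; rewrite inE => /orP[/eqP ->|/IH[e' h ->]].
  by exists e; [left|].
by exists e'; [right|].
Qed.

Lemma in_weighted c e : List.In e Es -> (ends e, c e) \in weighted c Es.
Proof.
rewrite /weighted; elim: Es => //= a l IH [->|/IH]; rewrite inE; first by rewrite eqxx.
by move=> ->; rewrite orbT.
Qed.

Lemma dirichlet_weighted c u f : dirichlet (weighted c Es) u f =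
  List.fold_right Rplus R0 (List.map (fun e =>
    Rmult (Rmult (c e) (Rminus (u (fst (ends e))) (u (snd (ends e)))))
          (Rminus (f (fst (ends e))) (f (snd (ends e))))) Es).
Proof.
by rewrite /dirichlet /weighted big_map; elim: Es => [|e l IH]; rewrite ?big_nil // big_cons IH.
Qed.

Hypothesis N0 : (0 < N)%coq_nat.
Hypothesis ends_lt : forall e, List.In e Es -> (fst (ends e) < N)%coq_nat /\ (snd (ends e) < N)%coq_nat.
Hypothesis conn : forall f : nat -> R,
  (forall e, List.In e Es -> f (fst (ends e)) = f (snd (ends e))) ->
  forall i j, (i < N)%coq_nat -> (j < N)%coq_nat -> f i = f j.

Lemma within_weighted c : within N (weighted c Es).
Proof. by move=> w /mem_weighted[e /ends_lt[h1 h2] ->]; split; apply/ssrnat.ltP. Qed.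

Lemma connected_weighted c : connected N (weighted c Es).
Proof.
move=> f hf i j /ssrnat.ltP hi /ssrnat.ltP hj; apply: conn => // e /(in_weighted c) he.
exact: (hf _ he).
Qed.

Lemma positive_weighted c : (forall e, List.In e Es -> Rlt R0 (c e)) -> positive (weighted c Es).
Proof. by move=> h w /mem_weighted[e /h /RltP he ->]. Qed.

Lemma det_lapl_weighted c :
  det_lapl N (List.map ends Es) (List.map c Es) = \det (lapl_mx N.-1 (weighted c Es)).
Proof. by move: N0; case: N => [/ssrnat.ltP //|n] _; rewrite det_lapl_eq combine_weighted. Qed.

Lemma det_lapl_gt0 c : (forall e, List.In e Es -> Rlt R0 (c e)) ->
  Rlt R0 (det_lapl N (List.map ends Es) (List.map c Es)).
Proof.
move=> hc; apply/RltP; rewrite det_lapl_weighted.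
move: (within_weighted c) (connected_weighted c) (positive_weighted c hc).
by move: N0; case: N => [/ssrnat.ltP //|n] _ h1 h2 h3; apply: det_lapl_mx_gt0.
Qed.

(** As [e] occurs only once in [Es], changing the conductance at [e] changes one entry of the
    weighted edge list. Quantifying over all [c'] that agree with [c] off [e] avoids deciding
    equality of labels. *)
Lemma det_lapl_update c e : (forall e, List.In e Es -> Rlt R0 (c e)) ->
  List.In e Es -> List.NoDup Es ->
  exists u : nat -> R,
  (forall f, Rminus (f (fst (ends e))) (f (snd (ends e))) =
     List.fold_right Rplus R0 (List.map (fun e =>
      Rmult (Rmult (c e) (Rminus (u (fst (ends e))) (u (snd (ends e)))))
          (Rminus (f (fst (ends e))) (f (snd (ends e))))) Es)) /\
  forall c' : T -> R, (forall e', List.In e' Es -> e' <> e -> c' e' = c e') ->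
  det_lapl N (List.map ends Es) (List.map c' Es) =
  Rmult (det_lapl N (List.map ends Es) (List.map c Es))
   (Rplus R1 (Rmult (Rminus (c' e) (c e)) (Rminus (u (fst (ends e))) (u (snd (ends e)))))).
Proof.
move=> hc he hd.
have [l1 [l2 El]] := List.in_split _ _ he.
have Ew (c' : T -> R) : (forall e', List.In e' Es -> e' <> e -> c' e' = c e') ->
    weighted c' Es = weighted c l1 ++ (ends e, c' e) :: weighted c l2.
  move=> h; have nd := List.NoDup_remove_2 l1 l2 e; rewrite El in hd h.
  have {}nd := nd hd; rewrite /weighted El.
  have -> : (l1 ++ e :: l2)%list = l1 ++ e :: l2 by [].
  rewrite map_cat /=; congr (_ ++ _ :: _).
    elim: {El hd} l1 h nd => //= a l IH h nd; rewrite h; [|by left|by move=> ae; apply: nd; left].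
    by rewrite IH // => [e' h1|h1]; [apply: h; right | apply: nd; right].
  have {h nd} : forall a, List.In a l2 -> c' a = c a.
    move=> a ha; apply: h; first by apply: List.in_or_app; right; right.
    by move=> ae; apply: nd; apply: List.in_or_app; right; rewrite -ae.
  by elim: {El hd} l2 => //= a l IH h; rewrite h; [rewrite IH // => b hb; apply: h; right | left].
move: (within_weighted c) (connected_weighted c) (positive_weighted c hc).
rewrite (Ew c) // => h1 h2 h3.
have NE : N = N.-1.+1 by rewrite prednK //; apply/ssrnat.ltP.
rewrite NE in h1 h2.
have [u [u1 u2]] := resistance_exists _ _ _ _ _ h1 h3 h2.
exists u; split => [f|c' hc'].
  by rewrite -dirichlet_weighted (Ew c) // -u1.
by rewrite !det_lapl_weighted (Ew c) // (Ew c') // u2.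
Qed.

Lemma det_lapl_scale c t : det_lapl N (List.map ends Es) (List.map (fun e => Rmult t (c e)) Es) =
  Rmult (pow t (N - 1)%coq_nat) (det_lapl N (List.map ends Es) (List.map c Es)).
Proof.
rewrite !det_lapl_weighted RpowE.
have -> : weighted (fun e => Rmult t (c e)) Es = [seq (w.1, t * w.2) | w <- weighted c Es].
  by rewrite /weighted -map_comp.
by rewrite lapl_mx_scale detZ; congr (_ ^+ _ * _); move: N0; case: N => //= n; rewrite Nat.sub_0_r.
Qed.
End Labelled.

End LaplacianDeterminant.

(** * Sums over configurations and stochastic domination *)

Definition sumL {A : Type} (l : list A) (f : A -> R) : R := fold_right Rplus 0 (map f l).

Lemma sumL_ext {A} (l : list A) f g : (forall a, In a l -> f a = g a) -> sumL l f = sumL l g.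
Proof.
  unfold sumL; induction l as [|a l IH]; intros H; simpl; auto.
  rewrite (H a), IH; auto with datatypes.
Qed.

Lemma sumL_le {A} (l : list A) f g : (forall a, In a l -> f a <= g a) -> sumL l f <= sumL l g.
Proof.
  unfold sumL; induction l as [|a l IH]; intros H; simpl; [lra|].
  apply Rplus_le_compat; auto with datatypes.
Qed.

Lemma sumL_plus {A} (l : list A) f g : sumL l (fun a => f a + g a) = sumL l f + sumL l g.
Proof. unfold sumL; induction l as [|a l IH]; simpl; lra. Qed.

Lemma sumL_scal {A} (l : list A) c f : sumL l (fun a => c * f a) = c * sumL l f.
Proof. unfold sumL; induction l as [|a l IH]; simpl; lra. Qed.

Lemma sumL_const {A} (l : list A) c : sumL l (fun _ => c) = c * INR (length l).
Proof. unfold sumL; induction l as [|a l IH]; cbn [map fold_right length]; [simpl; lra|]. rewrite S_INR; lra. Qed.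

Lemma sumL_nonneg {A} (l : list A) f : (forall a, In a l -> 0 <= f a) -> 0 <= sumL l f.
Proof.
  intros H. replace 0 with (sumL l (fun _ => 0)); [now apply sumL_le|].
  rewrite sumL_const; lra.
Qed.

Lemma sumL_app {A} (l l' : list A) f : sumL (l ++ l') f = sumL l f + sumL l' f.
Proof. unfold sumL; induction l as [|a l IH]; simpl; lra. Qed.

Lemma sumL_exchange {A B} (l : list A) (l' : list B) f :
  sumL l (fun a => sumL l' (f a)) = sumL l' (fun b => sumL l (fun a => f a b)).
Proof.
  induction l as [|a l IH].
  - change (0 = sumL l' (fun _ => 0)). rewrite sumL_const; ring.
  - change (sumL (a :: l) (fun a => sumL l' (f a))) with (sumL l' (f a) + sumL l (fun a => sumL l' (f a))).
    rewrite IH, <- sumL_plus. reflexivity.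
Qed.

(** Positive terms are matched with distinct entries of [l'], which are removed one by one. The
    shape is that of a contraction: discarded edges contribute nothing on the left, added edges
    something nonnegative on the right. *)
Lemma sumL_incl {A} (l l' : list A) f g : NoDup l ->
  (forall a, In a l -> f a <= 0 \/ In a l' /\ f a <= g a) ->
  (forall a, In a l' -> 0 <= g a) -> sumL l f <= sumL l' g.
Proof.
  intros nd; revert l'; induction nd as [|a l ha nd IH]; intros l' H Hg.
  - now apply sumL_nonneg.
  - change (f a + sumL l f <= sumL l' g).
    destruct (H a) as [h|[h1 h2]]; auto with datatypes.
    + specialize (IH l'). assert (sumL l f <= sumL l' g) by (apply IH; auto with datatypes). lra.
    + destruct (in_split _ _ h1) as (l1 & l2 & ->).
      assert (sumL l f <= sumL (l1 ++ l2) g).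
      { apply IH; [|intros b hb; apply Hg; apply in_app_or in hb; apply in_or_app; simpl; tauto].
        intros b hb; destruct (H b) as [h|[h3 h4]]; auto with datatypes.
        right; split; auto. apply in_app_or in h3; apply in_or_app; simpl in h3.
        destruct h3 as [h3|[->|h3]]; tauto. }
      rewrite sumL_app in *. change (sumL (a :: l2) g) with (g a + sumL l2 g). lra.
Qed.

(** * Configurations and correlation inequalities *)

Section Configurations.
Variable T : Type.
Variable T_dec : forall x y : T, {x = y} + {x <> y}.

Definition upd (k : T -> bool) (e : T) (b : bool) : T -> bool :=
  fun e' => if T_dec e e' then b else k e'.

Definition join (k1 k2 : T -> bool) : T -> bool := fun e => k1 e || k2 e.
Definition meet (k1 k2 : T -> bool) : T -> bool := fun e => k1 e && k2 e.
Definition below (k1 k2 : T -> bool) : Prop := forall e, k1 e = true -> k2 e = true.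

Lemma upd_same k e b : upd k e b e = b.
Proof. unfold upd; destruct (T_dec e e); congruence. Qed.

Lemma upd_other k e b e' : e <> e' -> upd k e b e' = k e'.
Proof. unfold upd; destruct (T_dec e e'); congruence. Qed.

Lemma upd_id k e b : k e = b -> upd k e b = k.
Proof.
  intros H; apply functional_extensionality; intros x; unfold upd.
  destruct (T_dec e x); congruence.
Qed.

Lemma upd_swap k e b e' b' : e <> e' -> upd (upd k e b) e' b' = upd (upd k e' b') e b.
Proof.
  intros H; apply functional_extensionality; intros x; unfold upd.
  destruct (T_dec e' x), (T_dec e x); congruence.
Qed.

(** Configurations live on the whole label type, with [k] as background outside [l]; networks with
    different edge sets thus share one configuration space. *)
Fixpoint csum (l : list T) (F : (T -> bool) -> R) (k : T -> bool) : R :=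
  match l with
  | nil => F k
  | e :: l' => csum l' F (upd k e true) + csum l' F (upd k e false)
  end.

Lemma csum_le l F G k :
  (forall k', (forall e, ~ In e l -> k' e = k e) -> F k' <= G k') ->
  csum l F k <= csum l G k.
Proof.
  revert k; induction l as [|e l IH]; intros k H; simpl; [auto|].
  apply Rplus_le_compat; apply IH; intros k' Hk'; apply H; intros e' he';
    simpl in he'; rewrite Hk', upd_other; first [reflexivity | tauto].
Qed.

Lemma csum_ext_on l F G k :
  (forall k', (forall e, ~ In e l -> k' e = k e) -> F k' = G k') ->
  csum l F k = csum l G k.
Proof. intros H; apply Rle_antisym; apply csum_le; intros k' h; rewrite (H k' h); lra. Qed.

Lemma csum_ext l F G k : (forall k', F k' = G k') -> csum l F k = csum l G k.
Proof. intros H; apply csum_ext_on; auto. Qed.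

Lemma csum_plus l F G k : csum l (fun k => F k + G k) k = csum l F k + csum l G k.
Proof. revert k; induction l as [|e l IH]; intros k; simpl; [lra|]. rewrite !IH; lra. Qed.

Lemma csum_scal l c F k : csum l (fun k => c * F k) k = c * csum l F k.
Proof. revert k; induction l as [|e l IH]; intros k; simpl; [lra|]. rewrite !IH; lra. Qed.

Lemma csum_nonneg l F k : (forall k, 0 <= F k) -> 0 <= csum l F k.
Proof.
  intros H; revert k; induction l as [|e l IH]; intros k; simpl; auto.
  apply Rplus_le_le_0_compat; auto.
Qed.

Lemma csum_pos l F k : (forall k, 0 < F k) -> 0 < csum l F k.
Proof.
  intros H; revert k; induction l as [|e l IH]; intros k; simpl; auto.
  apply Rplus_lt_0_compat; auto.
Qed.

Lemma csum_upd l F k e b : ~ In e l ->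
  csum l F (upd k e b) = csum l (fun k' => F (upd k' e b)) k.
Proof.
  revert k; induction l as [|a l IH]; intros k H; simpl; [auto|].
  simpl in H. rewrite !(upd_swap k e b a), !IH; first [reflexivity | intuition congruence].
Qed.

Lemma csum_app l l' F k : csum (l ++ l') F k = csum l (csum l' F) k.
Proof. revert k; induction l as [|e l IH]; intros k; simpl; [auto|]. now rewrite !IH. Qed.

Lemma csum_perm l l' F k : Permutation l l' -> csum l F k = csum l' F k.
Proof.
  intros H; revert k; induction H as [|e l l' H IH|e e' l|l1 l2 l3 H1 IH1 H2 IH2]; intros k; simpl.
  - reflexivity.
  - now rewrite !IH.
  - destruct (T_dec e e') as [->|n]; [reflexivity|].
    assert (H : forall b b', upd (upd k e b) e' b' = upd (upd k e' b') e b)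
      by (intros; now apply upd_swap).
    rewrite !H; lra.
  - now rewrite IH1.
Qed.

Definition local (l : list T) (F : (T -> bool) -> R) : Prop :=
  forall k k', (forall e, In e l -> k e = k' e) -> F k = F k'.

Lemma csum_local l F k k' : local l F -> csum l F k = csum l F k'.
Proof.
  intros HF.
  assert (H : forall l', (forall e, In e l -> In e l' \/ k e = k' e) ->
    csum l' F k = csum l' F k'); [|apply H; auto].
  intros l'; revert k k'; induction l' as [|a l' IH]; intros k k' H; simpl.
  - apply HF; intros e he; destruct (H e he); simpl in *; tauto.
  - f_equal; apply IH; intros e he; unfold upd; destruct (T_dec a e); auto;
      destruct (H e he) as [[]|]; tauto.
Qed.

Lemma sum_all_configs l (g : list bool -> R) k : NoDup l ->
  fold_right Rplus 0 (map g (all_configs (length l))) = csum l (fun k' => g (map k' l)) k.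
Proof.
  intros nd; revert g k; induction nd as [|e l he nd IH]; intros g k; simpl; [lra|].
  rewrite !csum_upd, <- csum_plus by assumption.
  transitivity (fold_right Rplus 0 (map (fun s => g (true :: s) + g (false :: s)) (all_configs (length l)))).
  - clear IH; induction (all_configs (length l)) as [|s L IHL]; cbn in *; [auto|]; lra.
  - rewrite (IH _ k); apply csum_ext; intros k'.
    assert (H : forall b, map (upd k' e b) l = map k' l).
    { intros b; apply map_ext_in; intros a ha; apply upd_other; congruence. }
    now rewrite !upd_same, !H.
Qed.

(** Only the mixed terms need an argument. With x = [a1 * b0], y = [a0 * b1], t = [c1 * d0] and u =
    [c0 * d1], one has x, y <= t and xy <= tu; then (t - x)(t - y) >= 0 gives t(x + y) <= t(t +
    u). *)
Lemma four_functions_bit a1 a0 b1 b0 c1 c0 d1 d0 :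
  0 <= a1 -> 0 <= a0 -> 0 <= b1 -> 0 <= b0 -> 0 <= c1 -> 0 <= c0 -> 0 <= d1 -> 0 <= d0 ->
  a1 * b1 <= c1 * d1 -> a1 * b0 <= c1 * d0 -> a0 * b1 <= c1 * d0 -> a0 * b0 <= c0 * d0 ->
  (a1 + a0) * (b1 + b0) <= (c1 + c0) * (d1 + d0).
Proof.
  intros. set (x := a1 * b0) in *; set (y := a0 * b1) in *; set (t := c1 * d0) in *.
  assert (hx : 0 <= x) by now apply Rmult_le_pos.
  assert (hy : 0 <= y) by now apply Rmult_le_pos.
  assert (hu : 0 <= c0 * d1) by now apply Rmult_le_pos.
  assert (hxy : x * y <= t * (c0 * d1)).
  { replace (x * y) with ((a1 * b1) * (a0 * b0)) by (unfold x, y; ring).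
    replace (t * (c0 * d1)) with ((c1 * d1) * (c0 * d0)) by (unfold t; ring).
    apply Rmult_le_compat; auto using Rmult_le_pos. }
  assert (x + y <= t + c0 * d1).
  { destruct (Req_dec t 0) as [h0|h0]; [lra|].
    apply (Rmult_le_reg_l t); [lra|].
    assert (0 <= (t - x) * (t - y)) by (apply Rmult_le_pos; lra). nra. }
  unfold x, y, t in *. lra.
Qed.

Lemma join_upd k1 k2 e b1 b2 : join (upd k1 e b1) (upd k2 e b2) = upd (join k1 k2) e (b1 || b2).
Proof.
  apply functional_extensionality; intros x; unfold join, upd; destruct (T_dec e x); auto.
Qed.

Lemma meet_upd k1 k2 e b1 b2 : meet (upd k1 e b1) (upd k2 e b2) = upd (meet k1 k2) e (b1 && b2).
Proof.
  apply functional_extensionality; intros x; unfold meet, upd; destruct (T_dec e x); auto.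
Qed.

(* Ahlswede-Daykin; only configurations that agree with the backgrounds [k1], [k2] outside [l] are constrained. *)
Lemma four_functions l al be ga de k1 k2 :
  (forall k, 0 <= al k) -> (forall k, 0 <= be k) -> (forall k, 0 <= ga k) -> (forall k, 0 <= de k) ->
  (forall x y, (forall e, ~ In e l -> x e = k1 e /\ y e = k2 e) ->
     al x * be y <= ga (join x y) * de (meet x y)) ->
  csum l al k1 * csum l be k2 <= csum l ga (join k1 k2) * csum l de (meet k1 k2).
Proof.
  intros Ha Hb Hc Hd; revert k1 k2; induction l as [|e l IH]; intros k1 k2 H; simpl.
  - apply H; auto.
  - assert (S : forall b1 b2, csum l al (upd k1 e b1) * csum l be (upd k2 e b2) <=
      csum l ga (upd (join k1 k2) e (b1 || b2)) * csum l de (upd (meet k1 k2) e (b1 && b2))).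
    { intros b1 b2; rewrite <- join_upd, <- meet_upd; apply IH.
      intros x y Hxy; apply H; intros a ha; simpl in ha.
      destruct (Hxy a) as [-> ->]; [tauto|]; rewrite !upd_other; first [reflexivity | split; reflexivity | tauto]. }
    apply four_functions_bit; try (now apply csum_nonneg).
    + exact (S true true).
    + exact (S true false).
    + exact (S false true).
    + exact (S false false).
Qed.

Lemma below_join k1 k2 : below k1 k2 -> join k1 k2 = k2.
Proof.
  intros H; apply functional_extensionality; intros e; unfold join; specialize (H e).
  destruct (k1 e), (k2 e); auto; simpl; symmetry; auto.
Qed.

Lemma below_meet k1 k2 : below k1 k2 -> meet k1 k2 = k1.
Proof.
  intros H; apply functional_extensionality; intros e; unfold meet; specialize (H e).
  destruct (k1 e), (k2 e); auto; simpl; auto.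
Qed.

(** Single-edge ratios suffice: the edges open in [x] and closed in [y] are closed in [x] one at a
    time. Each step multiplies the inequality for the smaller [x'] by the hypothesis for the ordered
    pair [x'], [join x' y] and cancels the common positive factor. *)
Lemma holley_condition (C : list T) w1 w2 :
  (forall k, 0 < w1 k) -> (forall k, 0 < w2 k) ->
  (forall e k1 k2, In e C -> below k1 k2 -> k1 e = false -> k2 e = false ->
     w1 (upd k1 e true) * w2 k2 <= w1 k1 * w2 (upd k2 e true)) ->
  forall x y, (forall e, x e = true -> y e = false -> In e C) ->
  w1 x * w2 y <= w1 (meet x y) * w2 (join x y).
Proof.
  intros p1 p2 H x y Hxy.
  assert (G : forall L, incl L C -> forall x, (forall e, x e = true -> y e = false -> In e L) ->
    w1 x * w2 y <= w1 (meet x y) * w2 (join x y)); [|apply (G C); auto using incl_refl].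
  clear x Hxy; induction L as [|e L IH]; intros HL x Hx.
  - assert (b : below x y).
    { intros e he; destruct (y e) eqn:E; auto. destruct (Hx e he E). }
    rewrite below_join, below_meet by assumption; lra.
  - assert (HL' : incl L C) by (intros a ha; apply HL; simpl; auto).
    destruct (x e) eqn:xe; [destruct (y e) eqn:ye|].
    + apply IH; auto. intros a h1 h2; destruct (Hx a h1 h2); [congruence|auto].
    + set (x' := upd x e false).
      assert (Ex : x = upd x' e true).
      { apply functional_extensionality; intros a; unfold x', upd; destruct (T_dec e a); congruence. }
      assert (Em : meet x y = meet x' y).
      { apply functional_extensionality; intros a; unfold meet, x', upd; destruct (T_dec e a) as [->|]; auto.
        rewrite ye; apply andb_false_r. }
      assert (Ej : join x y = upd (join x' y) e true).
      { apply functional_extensionality; intros a; unfold join, x', upd; destruct (T_dec e a) as [<-|]; auto.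
        now rewrite xe. }
      assert (I : w1 x' * w2 y <= w1 (meet x' y) * w2 (join x' y)).
      { apply IH; auto. intros a h1 h2; unfold x', upd in h1. destruct (T_dec e a); [discriminate|].
        destruct (Hx a h1 h2); [contradiction|auto]. }
      assert (J : w1 (upd x' e true) * w2 (join x' y) <= w1 x' * w2 (upd (join x' y) e true)).
      { apply H.
        - apply HL; simpl; auto.
        - intros a ha; unfold join; now rewrite ha.
        - apply upd_same.
        - unfold join, x'; now rewrite upd_same. }
      rewrite <- Ex, <- Ej in J; rewrite <- Em in I.
      pose proof (p1 x'); pose proof (p2 (join x' y)); pose proof (p1 x); pose proof (p2 y).
      pose proof (p1 (meet x y)); pose proof (p2 (join x y)).
      apply (Rmult_le_reg_l (w1 x' * w2 (join x' y))); [now apply Rmult_lt_0_compat|].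
      replace (w1 x' * w2 (join x' y) * (w1 x * w2 y)) with ((w1 x' * w2 y) * (w1 x * w2 (join x' y))) by ring.
      replace (w1 x' * w2 (join x' y) * (w1 (meet x y) * w2 (join x y)))
        with ((w1 (meet x y) * w2 (join x' y)) * (w1 x' * w2 (join x y))) by ring.
      apply Rmult_le_compat; auto; apply Rlt_le, Rmult_lt_0_compat; auto.
    + apply IH; auto. intros a h1 h2; destruct (Hx a h1 h2); [congruence|auto].
Qed.

Definition isotone (F : (T -> bool) -> R) : Prop := forall k k', below k k' -> F k <= F k'.

(** The four functions are F w1, w2, F w2 and w1. Ordered backgrounds guarantee that an edge open in
    the first and closed in the second configuration lies in [C], where the ratio condition is
    available. Cross-multiplication keeps the inequality summable over further edges. *)
Lemma domination_on (C : list T) w1 w2 F k1 k2 :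
  (forall k, 0 < w1 k) -> (forall k, 0 < w2 k) ->
  (forall e k1 k2, In e C -> below k1 k2 -> k1 e = false -> k2 e = false ->
     w1 (upd k1 e true) * w2 k2 <= w1 k1 * w2 (upd k2 e true)) ->
  (forall k, 0 <= F k) -> isotone F -> below k1 k2 ->
  csum C (fun k => F k * w1 k) k1 * csum C w2 k2 <=
  csum C (fun k => F k * w2 k) k2 * csum C w1 k1.
Proof.
  intros p1 p2 H F0 Fi b.
  pose proof (four_functions C (fun k => F k * w1 k) w2 (fun k => F k * w2 k) w1 k1 k2) as FF.
  rewrite below_join, below_meet in FF by assumption.
  apply FF; try (intros; apply Rlt_le; now auto); try (intros; apply Rmult_le_pos; auto using Rlt_le).
  intros x y Hxy.
  assert (h : w1 x * w2 y <= w1 (meet x y) * w2 (join x y)).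
  { apply (holley_condition C); auto. intros e h1 h2.
    destruct (in_dec T_dec e C) as [|n]; auto. destruct (Hxy e n) as [E1 E2].
    rewrite h1 in E1; rewrite h2 in E2; symmetry in E1; apply b in E1; congruence. }
  assert (f : F x <= F (join x y)) by (apply Fi; intros e he; unfold join; now rewrite he).
  rewrite !Rmult_assoc, (Rmult_comm (w2 _) (w1 _)).
  apply Rmult_le_compat; auto. apply Rlt_le, Rmult_lt_0_compat; auto.
Qed.

End Configurations.

Arguments upd {T} T_dec k e b.
Arguments join {T} k1 k2.
Arguments meet {T} k1 k2.
Arguments below {T} k1 k2.
Arguments csum {T} T_dec l F k.
Arguments local {T} l F.
Arguments isotone {T} F.

(** * Networks and contractions *)

(** Edges carry labels, so an edge keeps its identity when vertices are merged and one configuration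
    can be read in several networks, parallel edges and loops included. *)
Record network (T : Type) := Network { order : nat; edges : list T; ends : T -> nat * nat }.
Arguments Network {T}.
Arguments order {T}.
Arguments edges {T}.
Arguments ends {T}.

Record proper {T : Type} (G : network T) : Prop := {
  order_pos : (0 < order G)%nat;
  edges_nodup : NoDup (edges G);
  ends_lt : forall e, In e (edges G) -> (fst (ends G e) < order G)%nat /\ (snd (ends G e) < order G)%nat;
  edges_connect : forall f : nat -> R,
    (forall e, In e (edges G) -> f (fst (ends G e)) = f (snd (ends G e))) ->
    forall i j, (i < order G)%nat -> (j < order G)%nat -> f i = f j }.

(* [G2] arises from [G1] by identifying vertices, discarding edges that become loops, and adding vertices and edges. *)
Definition contracts {T : Type} (phi : nat -> nat) (G1 G2 : network T) : Prop :=
  forall e, In e (edges G1) ->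
    (In e (edges G2) -> phi (fst (ends G1 e)) = fst (ends G2 e) /\ phi (snd (ends G1 e)) = snd (ends G2 e)) /\
    (~ In e (edges G2) -> phi (fst (ends G1 e)) = phi (snd (ends G1 e))).

Section Networks.
Variable T : Type.
Variable T_dec : forall x y : T, {x = y} + {x <> y}.
Variable q : R.
Hypothesis hq : 1 <= q.

Definition conductance (k : T -> bool) (e : T) : R := if k e then q else 1.

Definition ldet (G : network T) (k : T -> bool) : R :=
  det_lapl (order G) (map (ends G) (edges G)) (map (conductance k) (edges G)).

Definition energy (G : network T) (c : T -> R) (u f : nat -> R) : R :=
  sumL (edges G) (fun e => c e * (u (fst (ends G e)) - u (snd (ends G e)))
                               * (f (fst (ends G e)) - f (snd (ends G e)))).

Definition wt (p : R) (G : network T) (k : T -> bool) : R :=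
  weight (order G) (map (ends G) (edges G)) p q (map k (edges G)).

Lemma conductance_pos k e : 0 < conductance k e.
Proof. unfold conductance; destruct (k e); lra. Qed.

Lemma ldet_pos G k : proper G -> 0 < ldet G k.
Proof.
  intros [h1 h2 h3 h4]; unfold ldet.
  apply (LaplacianDeterminant.det_lapl_gt0 _ _ _ _ h1 h3 h4).
  intros; apply conductance_pos.
Qed.

Lemma resistance G k e : proper G -> In e (edges G) -> k e = false ->
  exists u : nat -> R,
  (forall f, f (fst (ends G e)) - f (snd (ends G e)) = energy G (conductance k) u f) /\
  ldet G (upd T_dec k e true) =
    ldet G k * (1 + (q - 1) * (u (fst (ends G e)) - u (snd (ends G e)))).
Proof.
  intros [h1 h2 h3 h4] he ke.
  destruct (LaplacianDeterminant.det_lapl_update _ _ _ _ h1 h3 h4 (conductance k) e) as (u & u1 & u2);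
    auto using conductance_pos.
  exists u; split; [exact u1|].
  unfold ldet; rewrite (u2 (conductance (upd T_dec k e true))).
  - unfold conductance; now rewrite upd_same, ke.
  - intros e' _ n; unfold conductance; rewrite upd_other; auto.
Qed.

(** Expansion of the energy of u - f. Once that energy is bounded below by 0, this is the
    variational principle for the effective resistance. *)
Lemma energy_sub G c u f :
  energy G c (fun x => u x - f x) (fun x => u x - f x) + 2 * energy G c u f =
  energy G c u u + energy G c f f.
Proof.
  unfold energy. rewrite <- sumL_scal, <- !sumL_plus.
  apply sumL_ext; intros; ring.
Qed.

(* Rayleigh monotonicity, tested against the pullback of the potential of [G2] along [phi]. *)
Lemma ldet_ratio phi G1 G2 k1 k2 e :
  proper G1 -> proper G2 -> contracts phi G1 G2 ->
  below k1 k2 -> In e (edges G1) -> In e (edges G2) -> k1 e = false -> k2 e = false ->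
  ldet G1 k1 * ldet G2 (upd T_dec k2 e true) <= ldet G1 (upd T_dec k1 e true) * ldet G2 k2.
Proof.
  intros pr1 pr2 hphi hk he1 he2 ke1 ke2.
  destruct (resistance G1 k1 e) as (u1 & a1 & b1); auto.
  destruct (resistance G2 k2 e) as (u2 & a2 & b2); auto.
  pose proof (ldet_pos G1 k1 pr1); pose proof (ldet_pos G2 k2 pr2).
  set (f := fun x => u2 (phi x)).
  assert (Ef : energy G1 (conductance k1) f f <= energy G2 (conductance k2) u2 u2).
  { apply sumL_incl.
    - apply edges_nodup; auto.
    - intros a ha; destruct (hphi a ha) as [c1 c2].
      destruct (in_dec T_dec a (edges G2)) as [i|n].
      + right; split; auto. unfold f; destruct (c1 i) as [-> ->].
        rewrite !Rmult_assoc; apply Rmult_le_compat_r; [apply Rle_0_sqr|].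
        unfold conductance; specialize (hk a); destruct (k1 a); [rewrite hk by auto|destruct (k2 a)]; lra.
      + left; unfold f; rewrite (c2 n); lra.
    - intros a _; rewrite Rmult_assoc; apply Rmult_le_pos; [apply Rlt_le, conductance_pos|apply Rle_0_sqr]. }
  assert (Es : 0 <= energy G1 (conductance k1) (fun x => u1 x - f x) (fun x => u1 x - f x)).
  { apply sumL_nonneg; intros a _; rewrite Rmult_assoc; apply Rmult_le_pos;
      [apply Rlt_le, conductance_pos|apply Rle_0_sqr]. }
  (* With resistances r1 and r2 of [e] in the two networks, the reproducing identities turn this
     into 2 r2 <= r1 + energy(f) <= r1 + r2, hence r2 <= r1. *)
  pose proof (energy_sub G1 (conductance k1) u1 f) as Eq.
  rewrite <- !a1 in Eq; rewrite <- a2 in Ef.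
  destruct (hphi e he1) as [c1 _]; destruct (c1 he2) as [E1 E2].
  unfold f in Eq at 3 4; rewrite E1, E2 in Eq.
  rewrite b1, b2.
  set (r1 := u1 _ - u1 _) in *; set (r2 := u2 _ - u2 _) in *.
  replace (ldet G1 k1 * (ldet G2 k2 * (1 + (q - 1) * r2)))
    with ((ldet G1 k1 * ldet G2 k2) * (1 + (q - 1) * r2)) by ring.
  replace (ldet G1 k1 * (1 + (q - 1) * r1) * ldet G2 k2)
    with ((ldet G1 k1 * ldet G2 k2) * (1 + (q - 1) * r1)) by ring.
  apply Rmult_le_compat_l; [apply Rlt_le, Rmult_lt_0_compat; auto|].
  apply Rplus_le_compat_l, Rmult_le_compat_l; lra.
Qed.

(** * Weights, expectations and stochastic domination *)

Definition bernoulli (p : R) (s : list bool) : R :=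
  p ^ (count_occ bool_dec s true) * (1 - p) ^ (count_occ bool_dec s false).

Lemma bernoulli_cons p b s : bernoulli p (b :: s) = (if b then p else 1 - p) * bernoulli p s.
Proof. unfold bernoulli; destruct b; simpl; ring. Qed.

Lemma bernoulli_pos p s : 0 < p < 1 -> 0 < bernoulli p s.
Proof.
  intros hp; unfold bernoulli; apply Rmult_lt_0_compat; apply pow_lt; lra.
Qed.

Lemma bernoulli_upd p l k e : NoDup l -> In e l ->
  bernoulli p (map (upd T_dec k e true) l) * (1 - p) = p * bernoulli p (map (upd T_dec k e false) l).
Proof.
  intros nd; induction nd as [|a l ha nd IH]; intros he; [easy|]; simpl.
  rewrite !bernoulli_cons; destruct (T_dec e a) as [->|n].
  - rewrite !upd_same.
    assert (E : forall b, map (upd T_dec k a b) l = map k l).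
    { intros b; apply map_ext_in; intros c hc; apply upd_other; congruence. }
    rewrite !E; ring.
  - rewrite !upd_other by auto. destruct he as [->|he]; [easy|].
    rewrite Rmult_assoc, (IH he); ring.
Qed.

Lemma wt_eq p G k : wt p G k = bernoulli p (map k (edges G)) / sqrt (ldet G k).
Proof. unfold wt, weight, ldet, cond_of, bernoulli; now rewrite map_map. Qed.

Lemma wt_pos p G k : 0 < p < 1 -> proper G -> 0 < wt p G k.
Proof.
  intros hp pr; rewrite wt_eq; apply Rdiv_lt_0_compat; [now apply bernoulli_pos|].
  now apply sqrt_lt_R0, ldet_pos.
Qed.

Lemma wt_local p G : local (edges G) (wt p G).
Proof. intros k k' H; unfold wt; f_equal; now apply map_ext_in. Qed.

(** Opening [e] multiplies the Bernoulli factor by p/(1 - p) in both networks, so only the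
    determinants decide; their comparison passes through the square root and is reversed by the
    inverse. *)
Lemma wt_ratio p phi G1 G2 k1 k2 e : 0 < p < 1 ->
  proper G1 -> proper G2 -> contracts phi G1 G2 ->
  below k1 k2 -> In e (edges G1) -> In e (edges G2) -> k1 e = false -> k2 e = false ->
  wt p G1 (upd T_dec k1 e true) * wt p G2 k2 <= wt p G1 k1 * wt p G2 (upd T_dec k2 e true).
Proof.
  intros hp pr1 pr2 hphi hk he1 he2 ke1 ke2.
  pose proof (ldet_ratio phi G1 G2 k1 k2 e pr1 pr2 hphi hk he1 he2 ke1 ke2) as HD.
  pose proof (bernoulli_upd p (edges G1) k1 e (edges_nodup _ pr1) he1) as B1.
  pose proof (bernoulli_upd p (edges G2) k2 e (edges_nodup _ pr2) he2) as B2.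
  rewrite (upd_id _ T_dec k1 e false ke1) in B1. rewrite (upd_id _ T_dec k2 e false ke2) in B2.
  rewrite !wt_eq.
  pose proof (ldet_pos G1 k1 pr1) as d1; pose proof (ldet_pos G2 k2 pr2) as d2.
  pose proof (ldet_pos G1 (upd T_dec k1 e true) pr1) as d3; pose proof (ldet_pos G2 (upd T_dec k2 e true) pr2) as d4.
  apply sqrt_le_1 in HD; try (apply Rlt_le, Rmult_lt_0_compat; assumption).
  rewrite !sqrt_mult in HD by (apply Rlt_le; assumption).
  apply sqrt_lt_R0 in d1, d2, d3, d4.
  pose proof (bernoulli_pos p (map k1 (edges G1)) hp) as b1.
  pose proof (bernoulli_pos p (map k2 (edges G2)) hp) as b2.
  set (x1 := bernoulli p (map k1 (edges G1))) in *; set (x2 := bernoulli p (map k2 (edges G2))) in *.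
  set (y1 := bernoulli p (map (upd T_dec k1 e true) (edges G1))) in *.
  set (y2 := bernoulli p (map (upd T_dec k2 e true) (edges G2))) in *.
  assert (Y1 : y1 = p / (1 - p) * x1) by (apply (Rmult_eq_reg_r (1 - p)); [rewrite B1; field|]; lra).
  assert (Y2 : y2 = p / (1 - p) * x2) by (apply (Rmult_eq_reg_r (1 - p)); [rewrite B2; field|]; lra).
  set (s1 := sqrt (ldet G1 k1)) in *; set (s2 := sqrt (ldet G2 k2)) in *.
  set (s3 := sqrt (ldet G1 (upd T_dec k1 e true))) in *; set (s4 := sqrt (ldet G2 (upd T_dec k2 e true))) in *.
  rewrite Y1, Y2.
  replace (p / (1 - p) * x1 / s3 * (x2 / s2)) with (p / (1 - p) * x1 * x2 * / (s3 * s2)) by (field; lra).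
  replace (x1 / s1 * (p / (1 - p) * x2 / s4)) with (p / (1 - p) * x1 * x2 * / (s1 * s4)) by (field; lra).
  apply Rmult_le_compat_l.
  - assert (0 < p / (1 - p)) by (apply Rdiv_lt_0_compat; lra).
    apply Rmult_le_pos; [apply Rmult_le_pos|]; lra.
  - apply Rinv_le_contravar; auto. now apply Rmult_lt_0_compat.
Qed.

Definition zero_config : T -> bool := fun _ => false.
Definition one_config : T -> bool := fun _ => true.

Definition Zsum (p : R) (G : network T) : R := csum T_dec (edges G) (wt p G) zero_config.

Definition Ex (p : R) (G : network T) (F : (T -> bool) -> R) : R :=
  csum T_dec (edges G) (fun k => F k * wt p G k) zero_config / Zsum p G.

Lemma Zsum_pos p G : 0 < p < 1 -> proper G -> 0 < Zsum p G.
Proof. intros; apply csum_pos; intros; now apply wt_pos. Qed.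

Lemma prob_Ex p G ev : proper G ->
  prob (order G) (map (ends G) (edges G)) p q ev =
  Ex p G (fun k => if ev (map k (edges G)) then 1 else 0).
Proof.
  intros pr; unfold prob, Ex, Zsum. rewrite length_map.
  rewrite !(sum_all_configs T T_dec _ _ zero_config (edges_nodup _ pr)).
  f_equal; apply csum_ext; intros k; fold (wt p G k).
  destruct (ev _); ring.
Qed.

Lemma Ex_ext p G F F' : (forall k, F k = F' k) -> Ex p G F = Ex p G F'.
Proof. intros H; unfold Ex; f_equal; apply csum_ext; intros; now rewrite H. Qed.

Lemma Ex_plus p G F F' : Ex p G (fun k => F k + F' k) = Ex p G F + Ex p G F'.
Proof.
  unfold Ex; rewrite <- Rdiv_plus_distr, <- csum_plus; f_equal; apply csum_ext; intros; ring.
Qed.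

Lemma Ex_scal p G c F : Ex p G (fun k => c * F k) = c * Ex p G F.
Proof.
  unfold Ex, Rdiv; rewrite <- Rmult_assoc, <- csum_scal; f_equal; apply csum_ext; intros; ring.
Qed.

Lemma Ex_const p G c : 0 < p < 1 -> proper G -> Ex p G (fun _ => c) = c.
Proof.
  intros hp pr; pose proof (Zsum_pos p G hp pr).
  unfold Ex; rewrite csum_scal; fold (Zsum p G); field; lra.
Qed.

Lemma Ex_le p G F F' : 0 < p < 1 -> proper G -> (forall k, F k <= F' k) -> Ex p G F <= Ex p G F'.
Proof.
  intros hp pr H; pose proof (Zsum_pos p G hp pr).
  apply Rmult_le_compat_r; [now apply Rlt_le, Rinv_0_lt_compat|].
  apply csum_le; intros k _; apply Rmult_le_compat_r; [apply Rlt_le, wt_pos|]; auto.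
Qed.

Lemma Ex_sum {A : Type} p G (l : list A) F : 0 < p < 1 -> proper G ->
  Ex p G (fun k => sumL l (fun a => F a k)) = sumL l (fun a => Ex p G (F a)).
Proof.
  intros hp pr; induction l as [|a l IH].
  - exact (Ex_const p G 0 hp pr).
  - change (Ex p G (fun k => F a k + sumL l (fun a => F a k)) = Ex p G (F a) + sumL l (fun a => Ex p G (F a))).
    now rewrite Ex_plus, IH.
Qed.

Lemma incl_permutation (l l' : list T) : NoDup l -> NoDup l' -> incl l l' ->
  exists r, Permutation l' (r ++ l) /\ forall e, In e r -> ~ In e l.
Proof.
  intros nd nd' H; exists (filter (fun e => if in_dec T_dec e l then false else true) l'); split.
  - apply NoDup_Permutation; auto.
    + apply NoDup_app; auto using NoDup_filter.
      intros a ha; apply filter_In in ha as [_ ha]; now destruct (in_dec T_dec a l).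
    + intros a; rewrite in_app_iff, filter_In; destruct (in_dec T_dec a l); intuition (auto; discriminate).
  - intros a ha; apply filter_In in ha as [_ ha]; now destruct (in_dec T_dec a l).
Qed.

(** The two inclusions serve the two uses: a free box inside a larger one, and a large wired box
    contracted onto a smaller one. The surplus edges are summed last, and for each of their values
    [domination_on] applies to the common edges. In the first case the background of [G1] is all
    closed and lies below every other; in the second nothing attached to [G2] depends on the
    background. *)
Lemma domination p phi G1 G2 F : 0 < p < 1 ->
  proper G1 -> proper G2 -> contracts phi G1 G2 ->
  incl (edges G1) (edges G2) \/ incl (edges G2) (edges G1) /\ local (edges G2) F ->
  (forall k, 0 <= F k) -> isotone F -> Ex p G1 F <= Ex p G2 F.
Proof.
  intros hp pr1 pr2 hphi hinc F0 Fi.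
  pose proof (Zsum_pos p G1 hp pr1) as z1; pose proof (Zsum_pos p G2 hp pr2) as z2.
  unfold Ex. apply (Rmult_le_reg_r (Zsum p G1 * Zsum p G2)); [now apply Rmult_lt_0_compat|].
  replace (csum T_dec (edges G1) (fun k => F k * wt p G1 k) zero_config / Zsum p G1 * (Zsum p G1 * Zsum p G2))
    with (csum T_dec (edges G1) (fun k => F k * wt p G1 k) zero_config * Zsum p G2) by (field; lra).
  replace (csum T_dec (edges G2) (fun k => F k * wt p G2 k) zero_config / Zsum p G2 * (Zsum p G1 * Zsum p G2))
    with (Zsum p G1 * csum T_dec (edges G2) (fun k => F k * wt p G2 k) zero_config) by (field; lra).
  assert (step : forall C k1 k2, incl C (edges G1) -> incl C (edges G2) -> below k1 k2 ->
    csum T_dec C (fun k => F k * wt p G1 k) k1 * csum T_dec C (wt p G2) k2 <=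
    csum T_dec C (fun k => F k * wt p G2 k) k2 * csum T_dec C (wt p G1) k1).
  { intros C k1 k2 i1 i2 b; apply domination_on; auto; try (intros; now apply wt_pos).
    intros e j1 j2 he; intros; apply (wt_ratio p phi); auto. }
  destruct hinc as [inc|[inc loc]].
  - destruct (incl_permutation _ _ (edges_nodup _ pr1) (edges_nodup _ pr2) inc) as (r & hr & _).
    unfold Zsum; rewrite !(csum_perm _ T_dec _ _ _ _ hr), !csum_app, <- !csum_scal.
    apply csum_le; intros k' _. rewrite (Rmult_comm (csum _ _ (wt p G1) _)).
    apply step; auto using incl_refl. intros e he; discriminate.
  - destruct (incl_permutation _ _ (edges_nodup _ pr2) (edges_nodup _ pr1) inc) as (r & hr & _).
    unfold Zsum; rewrite !(csum_perm _ T_dec _ _ _ _ hr), !csum_app.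
    rewrite (Rmult_comm (csum _ r _ _)), (Rmult_comm (csum _ r _ _)), <- !csum_scal.
    apply csum_le; intros k' _.
    rewrite (csum_local _ T_dec (edges G2) (wt p G2) zero_config k') by apply wt_local.
    rewrite (csum_local _ T_dec (edges G2) (fun k => F k * wt p G2 k) zero_config k')
      by (intros x y h; now rewrite (loc x y h), (wt_local p G2 x y h)).
    rewrite (Rmult_comm (csum _ _ (wt p G2) _)). apply step; auto using incl_refl. now intros e.
Qed.

(** * Increments of the log-partition function *)

Definition open_count (G : network T) (k : T -> bool) : R :=
  sumL (edges G) (fun e => if k e then 1 else 0).

Definition log_odds_ratio (p p' : R) : R := ln (p' * (1 - p) / (p * (1 - p'))).

Lemma log_odds_ratio_exp p p' : 0 < p < 1 -> 0 < p' < 1 ->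
  exp (log_odds_ratio p p') = p' * (1 - p) / (p * (1 - p')).
Proof.
  intros; apply exp_ln, Rdiv_lt_0_compat; apply Rmult_lt_0_compat; lra.
Qed.

Lemma log_odds_ratio_pos p p' : 0 < p -> p < p' -> p' < 1 -> 0 < log_odds_ratio p p'.
Proof.
  intros; unfold log_odds_ratio; rewrite <- ln_1; apply ln_increasing; [lra|].
  apply (Rmult_lt_reg_r (p * (1 - p'))); [apply Rmult_lt_0_compat; lra|].
  unfold Rdiv; rewrite Rmult_assoc, Rinv_l; [nra|].
  apply Rgt_not_eq, Rmult_lt_0_compat; lra.
Qed.

(** Bernoulli weights form an exponential family in the number of open edges, with the log-odds as
    natural parameter. *)
Lemma bernoulli_tilt p p' (k : T -> bool) l : 0 < p < 1 -> 0 < p' < 1 ->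
  bernoulli p' (map k l) = ((1 - p') / (1 - p)) ^ (length l) *
    exp (log_odds_ratio p p' * sumL l (fun e => if k e then 1 else 0)) * bernoulli p (map k l).
Proof.
  intros hp hp'; induction l as [|e l IH].
  - unfold sumL, bernoulli; simpl; rewrite Rmult_0_r, exp_0; ring.
  - simpl map; rewrite !bernoulli_cons, IH.
    change (sumL (e :: l) (fun e => if k e then 1 else 0))
      with ((if k e then 1 else 0) + sumL l (fun e => if k e then 1 else 0)).
    rewrite Rmult_plus_distr_l, exp_plus; simpl length; simpl pow.
    destruct (k e).
    + rewrite Rmult_1_r, (log_odds_ratio_exp p p') by assumption. field; lra.
    + rewrite Rmult_0_r, exp_0. field; lra.
Qed.

Lemma wt_tilt p p' G k : 0 < p < 1 -> 0 < p' < 1 ->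
  wt p' G k = ((1 - p') / (1 - p)) ^ (length (edges G)) *
    (exp (log_odds_ratio p p' * open_count G k) * wt p G k).
Proof.
  intros hp hp'; rewrite !wt_eq, (bernoulli_tilt p p') by assumption.
  unfold open_count, Rdiv; ring.
Qed.

(** Jensen's inequality in tangent form: exp(l x) >= exp(l m)(1 + l x - l m), and the linear term
    averages to zero because m is the mean of x at [p]. Both signs of l are covered, which yields
    lower and upper bounds on increments. *)
Lemma Zsum_tilt p p' G : 0 < p < 1 -> 0 < p' < 1 -> proper G ->
  ((1 - p') / (1 - p)) ^ (length (edges G)) *
    exp (log_odds_ratio p p' * Ex p G (open_count G)) * Zsum p G <= Zsum p' G.
Proof.
  intros hp hp' pr. pose proof (Zsum_pos p G hp pr) as z.
  set (a := _ ^ _). set (l := log_odds_ratio p p'). set (m := Ex p G (open_count G)).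
  assert (a0 : 0 < a) by (apply pow_lt, Rdiv_lt_0_compat; lra).
  unfold Zsum at 2. rewrite (csum_ext _ T_dec _ (wt p' G)
    (fun k => a * (exp (l * open_count G k) * wt p G k))) by (intros; now apply wt_tilt).
  rewrite csum_scal, Rmult_assoc; apply Rmult_le_compat_l; [lra|].
  apply Rle_trans with (csum T_dec (edges G)
    (fun k => exp (l * m) * ((1 - l * m) * wt p G k + l * (open_count G k * wt p G k))) zero_config).
  - rewrite csum_scal, csum_plus, !csum_scal. fold (Zsum p G).
    assert (E : csum T_dec (edges G) (fun k => open_count G k * wt p G k) zero_config = m * Zsum p G)
      by (unfold m, Ex; field; lra).
    rewrite E. right; ring.
  - apply csum_le; intros k _.
    replace (exp (l * open_count G k)) with (exp (l * m) * exp (l * open_count G k - l * m))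
      by (rewrite <- exp_plus; f_equal; ring).
    rewrite Rmult_assoc; apply Rmult_le_compat_l; [apply Rlt_le, exp_pos|].
    replace ((1 - l * m) * wt p G k + l * (open_count G k * wt p G k))
      with ((1 + (l * open_count G k - l * m)) * wt p G k) by ring.
    apply Rmult_le_compat_r; [now apply Rlt_le, wt_pos|].
    destruct (Req_dec (l * open_count G k - l * m) 0) as [->|n]; [rewrite exp_0; lra|].
    now apply Rlt_le, exp_ineq1.
Qed.

Lemma ldet_one G : proper G -> ldet G one_config = q ^ (order G - 1) * ldet G zero_config.
Proof.
  intros pr; unfold ldet.
  rewrite <- (LaplacianDeterminant.det_lapl_scale _ _ _ _ (order_pos _ pr)).
  f_equal; apply map_ext; intros e; unfold conductance; simpl; ring.
Qed.

(* Cross-multiplied form of the monotonicity of [ldet G2 / ldet G1] in the configuration. *)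
Lemma ldet_sandwich phi G1 G2 k : proper G1 -> proper G2 -> contracts phi G1 G2 ->
  edges G1 = edges G2 ->
  ldet G1 zero_config * ldet G2 k <= ldet G1 k * ldet G2 zero_config /\
  ldet G1 k * ldet G2 one_config <= ldet G1 one_config * ldet G2 k.
Proof.
  intros pr1 pr2 hphi E.
  (* The exchange argument behind Holley's condition, applied to reciprocal determinants in place of
     weights; the claims are its instances at the pairs (k, all 1) and (all q, k). *)
  assert (H : forall x y, (forall e, x e = true -> y e = false -> In e (edges G1)) ->
    / ldet G1 x * / ldet G2 y <= / ldet G1 (meet x y) * / ldet G2 (join x y)).
  { apply (holley_condition _ T_dec _ (fun k => / ldet G1 k) (fun k => / ldet G2 k));
      try (intros; now apply Rinv_0_lt_compat, ldet_pos).
    intros e k1 k2 he b h1 h2. rewrite <- !Rinv_mult.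
    apply Rinv_le_contravar; [apply Rmult_lt_0_compat; now apply ldet_pos|].
    apply (ldet_ratio phi); auto. now rewrite <- E. }
  assert (Loc : forall G x y, (forall e, In e (edges G) -> x e = y e) -> ldet G x = ldet G y).
  { intros G x y h; unfold ldet; f_equal; apply map_ext_in; intros e he; unfold conductance; now rewrite h. }
  (* Closing all labels outside the network leaves determinants unchanged and confines disagreements
     to the edges, as the exchange inequality requires. *)
  set (on := fun x e => if in_dec T_dec e (edges G1) then x e else false : bool).
  assert (On1 : forall x, ldet G1 (on x) = ldet G1 x).
  { intros x; apply Loc; intros e he; unfold on; now destruct (in_dec T_dec e (edges G1)). }
  assert (On2 : forall x, ldet G2 (on x) = ldet G2 x).
  { intros x; apply Loc; intros e he; unfold on; rewrite <- E in he; now destruct (in_dec T_dec e (edges G1)). }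
  assert (H' : forall x y, ldet G1 (meet x y) * ldet G2 (join x y) <= ldet G1 x * ldet G2 y).
  { intros x y. specialize (H (on x) (on y)).
    assert (Em : meet (on x) (on y) = on (meet x y)).
    { apply functional_extensionality; intros e; unfold meet, on; now destruct (in_dec T_dec e (edges G1)). }
    assert (Ej : join (on x) (on y) = on (join x y)).
    { apply functional_extensionality; intros e; unfold join, on; now destruct (in_dec T_dec e (edges G1)). }
    rewrite Em, Ej, !On1, !On2, <- !Rinv_mult in H.
    pose proof (ldet_pos G1 x pr1); pose proof (ldet_pos G2 y pr2).
    pose proof (ldet_pos G1 (meet x y) pr1); pose proof (ldet_pos G2 (join x y) pr2).
    rewrite <- (Rinv_inv (_ * ldet G2 (join x y))), <- (Rinv_inv (_ * ldet G2 y)).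
    apply Rinv_le_contravar.
    - now apply Rinv_0_lt_compat, Rmult_lt_0_compat.
    - apply H. intros e h _; unfold on in h; destruct (in_dec T_dec e (edges G1)); [auto|discriminate]. }
  split.
  - rewrite <- (below_meet _ zero_config k), Rmult_comm at 1 by (intros e; discriminate).
    specialize (H' k zero_config).
    replace (meet k zero_config) with (meet zero_config k) in H'
      by (apply functional_extensionality; intros e; apply andb_comm).
    replace (join k zero_config) with k in H'
      by (apply functional_extensionality; intros e; unfold join; now rewrite orb_false_r).
    lra.
  - specialize (H' one_config k).
    rewrite (Rmult_comm (ldet G1 one_config)) in *.
    replace (meet one_config k) with k in H' by (apply functional_extensionality; intros e; reflexivity).
    replace (join one_config k) with one_config in H' by (apply functional_extensionality; intros e; reflexivity).
    lra.
Qed.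

(** The factor s is the ratio of the weights of [G2] and [G1] when all conductances are 1. It is
    chosen before [p], so that it cancels in increments of log-partition functions. By monotonicity
    and homogeneity the ratio of determinants varies by at most q^(order G1 - order G2), and the
    weights carry its square root. *)
Lemma Zsum_sandwich phi G1 G2 : proper G1 -> proper G2 -> contracts phi G1 G2 ->
  edges G1 = edges G2 -> (order G2 <= order G1)%nat ->
  exists s, 0 < s /\ forall p, 0 < p < 1 ->
    s * Zsum p G1 <= Zsum p G2 /\
    Zsum p G2 <= s * (sqrt (q ^ (order G1 - order G2)) * Zsum p G1).
Proof.
  intros pr1 pr2 hphi E ho.
  pose proof (ldet_pos G1 zero_config pr1) as d1; pose proof (ldet_pos G2 zero_config pr2) as d2.
  set (D1 := ldet G1 zero_config) in *; set (D2 := ldet G2 zero_config) in *.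
  set (K := q ^ (order G1 - order G2)).
  assert (K0 : 0 < K) by (apply pow_lt; lra).
  exists (sqrt D1 / sqrt D2); split; [now apply Rdiv_lt_0_compat; apply sqrt_lt_R0|].
  intros p hp.
  assert (P : forall k, sqrt D1 / sqrt D2 * wt p G1 k <= wt p G2 k /\
     wt p G2 k <= sqrt D1 / sqrt D2 * (sqrt K * wt p G1 k)).
  { intros k. rewrite !wt_eq, <- E.
    pose proof (bernoulli_pos p (map k (edges G1)) hp) as b; set (B := bernoulli _ _) in *.
    destruct (ldet_sandwich phi G1 G2 k pr1 pr2 hphi E) as [h1 h2].
    rewrite !ldet_one in h2 by assumption.
    fold D1 in h1, h2; fold D2 in h1, h2.
    replace (order G1 - 1)%nat with ((order G1 - order G2) + (order G2 - 1))%nat in h2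
      by (pose proof (order_pos _ pr2); lia).
    rewrite pow_add in h2; fold K in h2.
    assert (Q : 0 < q ^ (order G2 - 1)) by (apply pow_lt; lra).
    assert (h2' : ldet G1 k * D2 <= K * D1 * ldet G2 k).
    { apply (Rmult_le_reg_l (q ^ (order G2 - 1))); auto.
      replace (q ^ (order G2 - 1) * (ldet G1 k * D2)) with (ldet G1 k * (q ^ (order G2 - 1) * D2)) by ring.
      replace (q ^ (order G2 - 1) * (K * D1 * ldet G2 k)) with (K * q ^ (order G2 - 1) * D1 * ldet G2 k) by ring.
      exact h2. }
    clear h2.
    pose proof (ldet_pos G1 k pr1) as e1; pose proof (ldet_pos G2 k pr2) as e2.
    apply sqrt_le_1 in h1; try (apply Rlt_le, Rmult_lt_0_compat; assumption).
    apply sqrt_le_1 in h2'; try (repeat apply Rmult_le_pos; lra).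
    rewrite !sqrt_mult in h1 by lra.
    rewrite !sqrt_mult in h2' by (try apply Rmult_le_pos; lra).
    apply sqrt_lt_R0 in e1, e2, d1, d2, K0.
    set (x1 := sqrt D1) in *; set (x2 := sqrt D2) in *; set (y1 := sqrt (ldet G1 k)) in *;
    set (y2 := sqrt (ldet G2 k)) in *; set (z := sqrt K) in *.
    split.
    - apply (Rmult_le_reg_r (x2 * y1 * y2)); [repeat apply Rmult_lt_0_compat; assumption|].
      replace (x1 / x2 * (B / y1) * (x2 * y1 * y2)) with (B * (x1 * y2)) by (field; lra).
      replace (B / y2 * (x2 * y1 * y2)) with (B * (y1 * x2)) by (field; lra).
      apply Rmult_le_compat_l; lra.
    - apply (Rmult_le_reg_r (x2 * y1 * y2)); [repeat apply Rmult_lt_0_compat; assumption|].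
      replace (x1 / x2 * (z * (B / y1)) * (x2 * y1 * y2)) with (B * (z * x1 * y2)) by (field; lra).
      replace (B / y2 * (x2 * y1 * y2)) with (B * (y1 * x2)) by (field; lra).
      apply Rmult_le_compat_l; lra. }
  unfold Zsum; rewrite <- E, <- !csum_scal.
  split; apply csum_le; intros k _; apply P.
Qed.

(* Jensen's inequality bounds the log-partition increment of [G2] from its mean at [p] and that of [G1] from its mean at [p']. *)
Lemma density_gap phi G1 G2 p p' : proper G1 -> proper G2 -> contracts phi G1 G2 ->
  edges G1 = edges G2 -> (order G2 <= order G1)%nat -> 0 < p -> p < p' -> p' < 1 ->
  log_odds_ratio p p' * (Ex p G2 (open_count G2) - Ex p' G1 (open_count G1)) <=
  INR (order G1 - order G2) * (ln q / 2).
Proof.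
  intros pr1 pr2 hphi E ho h0 hpp h1.
  assert (hp : 0 < p < 1) by lra. assert (hp' : 0 < p' < 1) by lra.
  destruct (Zsum_sandwich phi G1 G2 pr1 pr2 hphi E ho) as (s & s0 & hs).
  destruct (hs p hp) as [A1 _]; destruct (hs p' hp') as [_ A2].
  pose proof (Zsum_tilt p p' G2 hp hp' pr2) as T2.
  (* Exchanging the parameters changes the sign of l and turns the lower bound into an upper bound
     for the partition function of [G1] at [p']. *)
  pose proof (Zsum_tilt p' p G1 hp' hp pr1) as T1.
  rewrite <- E in T2.
  set (n := length (edges G1)) in *.
  set (l := log_odds_ratio p p') in *.
  assert (L : log_odds_ratio p' p = - l).
  { unfold l, log_odds_ratio. rewrite <- ln_Rinv by (apply Rdiv_lt_0_compat; apply Rmult_lt_0_compat; lra).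
    f_equal; field; lra. }
  rewrite L in T1.
  set (m2 := Ex p G2 (open_count G2)) in *; set (m1 := Ex p' G1 (open_count G1)) in *.
  assert (a0 : 0 < ((1 - p') / (1 - p)) ^ n) by (apply pow_lt, Rdiv_lt_0_compat; lra).
  assert (Ea : ((1 - p) / (1 - p')) ^ n = / ((1 - p') / (1 - p)) ^ n).
  { rewrite <- pow_inv; f_equal; field; lra. }
  rewrite Ea in T1; set (a := ((1 - p') / (1 - p)) ^ n) in *.
  pose proof (Zsum_pos p G1 hp pr1) as z1; pose proof (Zsum_pos p' G1 hp' pr1) as z1'.
  set (K := q ^ (order G1 - order G2)) in *.
  assert (K0 : 0 < K) by (apply pow_lt; lra).
  pose proof (sqrt_lt_R0 K K0) as sK.
  assert (T1' : Zsum p' G1 <= a * exp (l * m1) * Zsum p G1).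
  { apply (Rmult_le_reg_l (/ a * exp (- l * m1))).
    - apply Rmult_lt_0_compat; [now apply Rinv_0_lt_compat|apply exp_pos].
    - replace (/ a * exp (- l * m1) * (a * exp (l * m1) * Zsum p G1))
        with ((exp (- l * m1) * exp (l * m1)) * Zsum p G1) by (field; lra).
      rewrite <- exp_plus. replace (- l * m1 + l * m1) with 0 by ring. rewrite exp_0; lra. }
  (* The chain runs from [G2] at [p] to [G2] at [p'] by tilting, to [G1] at [p'] by the sandwich,
     and back to [G1] at [p] by the reversed tilt; the lower half of the sandwich at [p] closes it
     and s cancels. *)
  assert (M : exp (l * m2) <= sqrt K * exp (l * m1)).
  { apply (Rmult_le_reg_l (a * s * Zsum p G1)); [repeat apply Rmult_lt_0_compat; auto|].
    apply Rle_trans with (a * exp (l * m2) * Zsum p G2).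
    - replace (a * s * Zsum p G1 * exp (l * m2)) with (a * exp (l * m2) * (s * Zsum p G1)) by ring.
      apply Rmult_le_compat_l; auto. apply Rlt_le, Rmult_lt_0_compat; auto. apply exp_pos.
    - apply Rle_trans with (s * (sqrt K * Zsum p' G1)); [lra|].
      replace (a * s * Zsum p G1 * (sqrt K * exp (l * m1)))
        with (s * (sqrt K * (a * exp (l * m1) * Zsum p G1))) by ring.
      apply Rmult_le_compat_l; [lra|]. apply Rmult_le_compat_l; lra. }
  assert (lnK : ln (sqrt K) = INR (order G1 - order G2) * (ln q / 2)).
  { assert (D : ln K = 2 * ln (sqrt K)).
    { rewrite <- (sqrt_sqrt K) at 1 by lra. rewrite ln_mult by auto. ring. }
    unfold K in D at 1; rewrite ln_pow in D by lra. lra. }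
  rewrite <- lnK.
  rewrite <- (exp_ln (sqrt K)), <- exp_plus in M by auto.
  destruct (Rle_lt_dec (l * (m2 - m1)) (ln (sqrt K))) as [|n0]; auto.
  assert (exp (ln (sqrt K) + l * m1) < exp (l * m2)) by (apply exp_increasing; lra).
  lra.
Qed.

End Networks.

(** * Free and wired boxes *)

Lemma zedge_dec (e e' : zedge) : {e = e'} + {e <> e'}.
Proof. decide equality; [apply Nat.eq_dec|apply list_eq_dec, Z.eq_dec]. Defined.

Lemma point_eqb_spec x y : reflect (x = y) (point_eqb x y).
Proof. unfold point_eqb; destruct (list_eq_dec Z.eq_dec x y); now constructor. Qed.

Lemma nth_pos x l y : In x l -> nth (pos x l) l y = x.
Proof.
  induction l as [|a l IH]; [easy|]; intros h; simpl.
  destruct (point_eqb_spec x a) as [->|n]; [reflexivity|].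
  destruct h as [->|h]; [easy|auto].
Qed.

Lemma pos_lt x l : In x l -> (pos x l < length l)%nat.
Proof.
  induction l as [|a l IH]; [easy|]; intros h; simpl.
  destruct (point_eqb_spec x a) as [->|n]; [lia|].
  destruct h as [->|h]; [easy|]. specialize (IH h); lia.
Qed.

Lemma pos_nth i l y : NoDup l -> (i < length l)%nat -> pos (nth i l y) l = i.
Proof.
  intros nd; revert i; induction nd as [|a l ha nd IH]; intros i hi; simpl in *; [lia|].
  destruct i as [|i]; simpl.
  - now destruct (point_eqb_spec a a).
  - destruct (point_eqb_spec (nth i l y) a) as [E|n].
    + exfalso; apply ha; rewrite <- E; apply nth_In; lia.
    + rewrite IH; lia.
Qed.

Lemma in_zrange z n : In z (zrange n) <-> (Z.abs z <= Z.of_nat n)%Z.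
Proof.
  unfold zrange; rewrite in_map_iff; split.
  - intros (k & <- & hk); apply in_seq in hk; lia.
  - intros h; exists (Z.to_nat (z + Z.of_nat n)); rewrite in_seq; lia.
Qed.

Lemma zrange_nodup n : NoDup (zrange n).
Proof. apply FinFun.Injective_map_NoDup; [intros a b; lia|apply seq_NoDup]. Qed.

Lemma in_box_spec n x : in_box n x = true <-> forall z, In z x -> (Z.abs z <= Z.of_nat n)%Z.
Proof.
  unfold in_box; rewrite forallb_forall; split; intros H z hz; specialize (H z hz);
    now apply Z.leb_le.
Qed.

Lemma on_boundary_spec n x :
  on_boundary n x = true <-> exists z, In z x /\ Z.abs z = Z.of_nat n.
Proof.
  unfold on_boundary; rewrite existsb_exists; split; intros (z & h1 & h2); exists z;
    split; auto; now apply Z.eqb_eq.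
Qed.

Lemma in_box_iff d n x : In x (box d n) <-> length x = d /\ in_box n x = true.
Proof.
  revert x; induction d as [|d IH]; intros x; simpl.
  - split; [intros [<-|[]]; auto|]. intros [h _]; left; destruct x; easy.
  - rewrite in_flat_map; split.
    + intros (z & hz & hx); apply in_map_iff in hx as (y & <- & hy).
      apply IH in hy as [h1 h2]; apply in_zrange in hz; simpl; split; [lia|].
      rewrite h2, andb_true_r; now apply Z.leb_le.
    + intros [h1 h2]; destruct x as [|z y]; [easy|].
      simpl in h1, h2; apply andb_true_iff in h2 as [h2 h3].
      exists z; rewrite in_zrange, in_map_iff; split; [now apply Z.leb_le|].
      exists y; split; auto; apply IH; split; [lia|auto].
Qed.

Lemma box_nodup d n : NoDup (box d n).
Proof.
  induction d as [|d IH]; simpl; [repeat constructor; easy|].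
  pose proof (zrange_nodup n) as nd; induction nd as [|z l hz nd IHl]; simpl; [constructor|].
  apply NoDup_app; auto.
  - apply FinFun.Injective_map_NoDup; auto. intros a b; congruence.
  - intros x hx hx'; apply in_map_iff in hx as (y & <- & _).
    apply in_flat_map in hx' as (w & hw & h); apply in_map_iff in h as (y' & E & _). congruence.
Qed.

Lemma box_length d n : length (box d n) = ((2 * n + 1) ^ d)%nat.
Proof.
  induction d as [|d IH]; [reflexivity|]. cbn [box].
  rewrite (flat_map_constant_length (c := ((2 * n + 1) ^ d)%nat)).
  - unfold zrange; rewrite length_map, length_seq; simpl; lia.
  - intros z _; now rewrite length_map.
Qed.

Lemma in_interior d n x : In x (interior d n) <->
  length x = d /\ forall z, In z x -> (Z.abs z < Z.of_nat n)%Z.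
Proof.
  unfold interior; rewrite filter_In, in_box_iff, in_box_spec, negb_true_iff; split.
  - intros [[h1 h2] h3]; split; auto; intros z hz. specialize (h2 z hz).
    assert (Z.abs z <> Z.of_nat n); [|lia].
    intros E; assert (on_boundary n x = true); [|congruence].
    apply on_boundary_spec; eauto.
  - intros [h1 h2]; repeat split; auto.
    + intros z hz; specialize (h2 z hz); lia.
    + apply not_true_iff_false; rewrite on_boundary_spec; intros (z & hz & E).
      specialize (h2 z hz); lia.
Qed.

Lemma interior_incl d n x : In x (interior d n) -> In x (box d n).
Proof. intros h; now apply filter_In in h. Qed.

Lemma interior_nodup d n : NoDup (interior d n).
Proof. apply NoDup_filter, box_nodup. Qed.

Lemma interior_length d n : length (interior d (S n)) = length (box d n).
Proof.
  apply Permutation_length, NoDup_Permutation; auto using interior_nodup, box_nodup.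
  intros x; rewrite in_interior, in_box_iff, in_box_spec.
  split; intros [h1 h2]; split; auto; intros z hz; specialize (h2 z hz); lia.
Qed.

Lemma shift_length x i : length (shift x i) = length x.
Proof. revert i; induction x as [|z x IH]; intros [|i]; simpl; auto. Qed.

Lemma shift_coord x i z : In z (shift x i) -> In z x \/ In (z - 1)%Z x.
Proof.
  revert i; induction x as [|w x IH]; intros [|i]; simpl; try easy.
  - intros [<-|h]; auto. right; left; lia.
  - intros [<-|h]; auto. destruct (IH _ h); auto.
Qed.

Lemma shift_coord_inv x i z : In z x -> In z (shift x i) \/ In (z + 1)%Z (shift x i).
Proof.
  revert i; induction x as [|w x IH]; intros [|i]; simpl; try easy.
  - intros [<-|h]; auto.
  - intros [<-|h]; auto. destruct (IH i h); auto.
Qed.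

Lemma in_box_edges d n x i : In (x, i) (box_edges d n) <->
  In x (box d n) /\ (i < d)%nat /\ In (shift x i) (box d n).
Proof.
  unfold box_edges; rewrite in_flat_map; split.
  - intros (y & hy & h); apply in_map_iff in h as (j & E & hj); injection E as -> ->.
    apply filter_In in hj as [h1 h2]; apply in_seq in h1.
    repeat split; auto; [lia|]. apply in_box_iff; rewrite shift_length.
    apply in_box_iff in hy as [h _]; auto.
  - intros (h1 & h2 & h3); exists x; split; auto; apply in_map, filter_In.
    split; [apply in_seq; lia|now apply in_box_iff in h3].
Qed.

Lemma box_edges_nodup d n : NoDup (box_edges d n).
Proof.
  unfold box_edges; pose proof (box_nodup d n) as nd; induction nd as [|x l hx nd IH]; simpl; [constructor|].
  apply NoDup_app; auto.
  - apply FinFun.Injective_map_NoDup; [intros a b; congruence|apply NoDup_filter, seq_NoDup].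
  - intros e he he'; apply in_map_iff in he as (i & <- & _).
    apply in_flat_map in he' as (y & hy & h); apply in_map_iff in h as (j & E & _). congruence.
Qed.

Lemma box_edges_length d n : (length (box_edges d n) <= d * length (box d n))%nat.
Proof.
  unfold box_edges; induction (box d n) as [|x l IH]; simpl; [lia|].
  rewrite length_app, length_map.
  pose proof (filter_length_le (fun i => in_box n (shift x i)) (seq 0 d)) as h.
  rewrite length_seq in h.
  apply Nat.le_trans with (d + d * length l)%nat; [now apply Nat.add_le_mono|lia].
Qed.

Lemma walk (n : nat) (g : Z -> R) :
  (forall z, (Z.abs z <= Z.of_nat n)%Z -> (Z.abs (z + 1) <= Z.of_nat n)%Z -> g z = g (z + 1)%Z) ->
  forall z w, (Z.abs z <= Z.of_nat n)%Z -> (Z.abs w <= Z.of_nat n)%Z -> g z = g w.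
Proof.
  intros H.
  assert (L : forall k, (Z.of_nat k <= 2 * Z.of_nat n)%Z -> g (Z.of_nat k - Z.of_nat n)%Z = g (- Z.of_nat n)%Z).
  { induction k as [|k IH]; intros hk; [f_equal; lia|].
    rewrite <- IH, (H (Z.of_nat k - Z.of_nat n)%Z) by lia. f_equal; lia. }
  intros z w hz hw.
  transitivity (g (- Z.of_nat n)%Z).
  - rewrite <- (L (Z.to_nat (z + Z.of_nat n))) by lia; f_equal; lia.
  - rewrite <- (L (Z.to_nat (w + Z.of_nat n))) by lia; f_equal; lia.
Qed.

Lemma box_connected d n (f : point -> R) :
  (forall x i, In (x, i) (box_edges d n) -> f x = f (shift x i)) ->
  forall x y, In x (box d n) -> In y (box d n) -> f x = f y.
Proof.
  intros H x y hx hy.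
  assert (H' : forall x i, In x (box d n) -> (i < d)%nat -> In (shift x i) (box d n) -> f x = f (shift x i)).
  { intros; apply H, in_box_edges; auto. }
  clear H; revert f H' x y hx hy; induction d as [|d IH]; intros f H x y hx hy.
  - simpl in hx, hy; intuition congruence.
  - destruct x as [|z x]; [now apply in_box_iff in hx|].
    destruct y as [|w y]; [now apply in_box_iff in hy|].
    assert (C : forall z x, In (z :: x) (box (S d) n) <-> (Z.abs z <= Z.of_nat n)%Z /\ In x (box d n)).
    { intros; rewrite !in_box_iff; simpl; rewrite andb_true_iff, Z.leb_le. intuition lia. }
    apply C in hx as [hz hx]; apply C in hy as [hw hy].
    transitivity (f (w :: x)).
    + apply (walk n (fun z => f (z :: x))); auto.
      intros v h1 h2. apply (H (v :: x) 0%nat); [apply C; auto|lia|apply C; auto].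
    + apply (IH (fun x => f (w :: x))); auto.
      intros v i h1 h2 h3. apply (H (w :: v) (S i)); [apply C; auto|lia|apply C; auto].
Qed.

(** Free, wired and translated boxes differ only in the edge list and in the numbering [v] of points
    by vertices. *)
Definition lattice_network (N : nat) (Es : list zedge) (v : point -> nat) : network zedge :=
  Network N Es (fun e => (v (fst e), v (shift (fst e) (snd e)))).

Definition free_network (d n : nat) : network zedge :=
  lattice_network (free_N d n) (box_edges d n) (fun x => pos x (box d n)).

Definition wired_network (d n : nat) : network zedge :=
  lattice_network (wired_N d n) (box_edges d n) (wired_index d n).

Lemma box_lattice_proper d n N v :
  (0 < N)%nat ->
  (forall x, In x (box d n) -> (v x < N)%nat) ->
  (forall i, (i < N)%nat -> exists x, In x (box d n) /\ v x = i) ->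
  proper (lattice_network N (box_edges d n) v).
Proof.
  intros h0 hlt hsur; constructor; simpl; auto using box_edges_nodup.
  - intros [x i] he; apply in_box_edges in he as (h1 & h2 & h3); simpl; auto.
  - intros f H i j hi hj.
    destruct (hsur i hi) as (x & hx & <-); destruct (hsur j hj) as (y & hy & <-).
    apply (box_connected d n (fun x => f (v x))); auto.
    intros u k hu; apply (H (u, k) hu).
Qed.

Lemma free_proper d n : proper (free_network d n).
Proof.
  apply box_lattice_proper; unfold free_N.
  - rewrite box_length. apply Nat.neq_0_lt_0, Nat.pow_nonzero; lia.
  - intros; now apply pos_lt.
  - intros i hi; exists (nth i (box d n) nil); split; [now apply nth_In|].
    apply pos_nth; auto using box_nodup.
Qed.

Lemma wired_index_interior d n x : In x (interior d n) ->
  wired_index d n x = S (pos x (interior d n)).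
Proof.
  intros h; unfold wired_index; apply filter_In in h as [_ h].
  now apply negb_true_iff in h as ->.
Qed.

Lemma wired_proper d n : (0 < d)%nat -> proper (wired_network d n).
Proof.
  intros hd; apply box_lattice_proper; unfold wired_N; [lia| |].
  - intros x hx; unfold wired_index; destruct (on_boundary n x) eqn:E; [lia|].
    apply -> Nat.succ_lt_mono; apply pos_lt, filter_In; now rewrite E.
  - intros [|i] hi.
    + exists (repeat (Z.of_nat n) d); split.
      * apply in_box_iff; rewrite repeat_length, in_box_spec; split; auto.
        intros z hz; apply repeat_spec in hz; lia.
      * unfold wired_index; replace (on_boundary n _) with true; auto.
        symmetry; apply on_boundary_spec; exists (Z.of_nat n); split; [|lia].
        destruct d; [lia|simpl; auto].
    + assert (h : In (nth i (interior d n) nil) (interior d n)) by (apply nth_In; lia).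
      exists (nth i (interior d n) nil); split; [now apply interior_incl|].
      rewrite wired_index_interior, pos_nth; auto using interior_nodup; lia.
Qed.

Lemma free_contracts_wired d n :
  contracts (fun k => wired_index d n (nth k (box d n) nil)) (free_network d n) (wired_network d n).
Proof.
  intros [x i] he; pose proof he as h; apply in_box_edges in h as (h1 & h2 & h3).
  simpl; rewrite !nth_pos by assumption. tauto.
Qed.

(** * Translations of boxes *)

Definition vadd (x t : point) : point := map (fun zw => (fst zw + snd zw)%Z) (combine x t).
Definition vopp (t : point) : point := map Z.opp t.

Lemma vadd_length x t : length x = length t -> length (vadd x t) = length t.
Proof. intros h; unfold vadd; rewrite length_map, length_combine; lia. Qed.

Lemma vopp_length t : length (vopp t) = length t.
Proof. apply length_map. Qed.

Lemma vopp_involutive t : vopp (vopp t) = t.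
Proof. unfold vopp; induction t as [|z t IH]; simpl; f_equal; auto; lia. Qed.

Lemma vadd_opp x t : length x = length t -> vadd (vadd x t) (vopp t) = x.
Proof.
  revert t; induction x as [|z x IH]; intros [|w t] h; simpl in *; try easy.
  unfold vadd, vopp in *; simpl; f_equal; [lia|]; apply IH; lia.
Qed.

Lemma vadd_opp' x t : length x = length t -> vadd (vadd x (vopp t)) t = x.
Proof.
  intros h. rewrite <- (vopp_involutive t) at 2. apply vadd_opp; now rewrite vopp_length.
Qed.

Lemma vadd_shift x t i : length x = length t -> vadd (shift x i) t = shift (vadd x t) i.
Proof.
  revert t i; induction x as [|z x IH]; intros [|w t] [|i] h; simpl in *; try easy.
  - unfold vadd; simpl; f_equal; lia.
  - unfold vadd in *; simpl; f_equal; apply IH; lia.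
Qed.

Lemma vadd_coord x t z : In z (vadd x t) -> exists a b, In a x /\ In b t /\ z = (a + b)%Z.
Proof.
  unfold vadd; intros h; apply in_map_iff in h as ([a b] & <- & h).
  exists a, b; split; [|split]; auto; [eapply in_combine_l|eapply in_combine_r]; eauto.
Qed.

Definition bounded_by (r : nat) (t : point) : Prop := forall z, In z t -> (Z.abs z <= Z.of_nat r)%Z.

Lemma vadd_bounded x t a b : bounded_by a x -> bounded_by b t -> bounded_by (a + b) (vadd x t).
Proof.
  intros hx ht z hz; apply vadd_coord in hz as (u & v & h1 & h2 & ->).
  specialize (hx u h1); specialize (ht v h2); lia.
Qed.

Lemma vopp_bounded t a : bounded_by a t -> bounded_by a (vopp t).
Proof. intros h z hz; apply in_map_iff in hz as (w & <- & hw); specialize (h w hw); lia. Qed.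

Definition translate (t : point) (e : zedge) : zedge := (vadd (fst e) t, snd e).

(** The box moved by -t. Only the labels move: the list of numbered endpoints stays that of the
    original box, so both networks give literally the same [prob]. *)
Definition translated (t : point) (N : nat) (Es : list zedge) (v : point -> nat) : network zedge :=
  lattice_network N (map (translate (vopp t)) Es) (fun x => v (vadd x t)).

Lemma in_translated_edges d n t y i : length t = d -> length y = d ->
  In (y, i) (map (translate (vopp t)) (box_edges d n)) <-> In (vadd y t, i) (box_edges d n).
Proof.
  intros ht hy; rewrite in_map_iff; split.
  - intros ([x j] & E & h); unfold translate in E; simpl in E; injection E as E1 E2; subst y j.
    pose proof h as h'; apply in_box_edges in h' as [h' _]; apply in_box_iff in h' as [h' _].
    rewrite vadd_opp'; [auto|lia].
  - intros h; exists (vadd y t, i); split; auto. unfold translate; simpl; f_equal.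
    apply vadd_opp; lia.
Qed.

Lemma translated_edges_length d n t y i : length t = d ->
  In (y, i) (map (translate (vopp t)) (box_edges d n)) -> length y = d.
Proof.
  intros ht h; apply in_map_iff in h as ([x j] & E & h); unfold translate in E; simpl in E.
  injection E as <- <-. apply in_box_edges in h as [h _]; apply in_box_iff in h as [h _].
  rewrite vadd_length, vopp_length; auto; rewrite vopp_length; lia.
Qed.

Lemma translated_ends d n t N v e : length t = d -> In e (box_edges d n) ->
  ends (translated t N (box_edges d n) v) (translate (vopp t) e) =
  ends (lattice_network N (box_edges d n) v) e.
Proof.
  intros ht h; destruct e as [x i]; apply in_box_edges in h as [h _]; apply in_box_iff in h as [h _].
  simpl. rewrite vadd_shift, vadd_opp'; auto; try lia.
  rewrite vadd_length; rewrite vopp_length; lia.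
Qed.

Lemma translated_end_list d n t N v : length t = d ->
  map (ends (translated t N (box_edges d n) v)) (edges (translated t N (box_edges d n) v)) =
  map (ends (lattice_network N (box_edges d n) v)) (box_edges d n).
Proof.
  intros ht. unfold translated at 2; simpl edges. rewrite map_map; apply map_ext_in; intros e he.
  now apply translated_ends.
Qed.

Lemma translated_proper d n t N v : length t = d ->
  proper (lattice_network N (box_edges d n) v) -> proper (translated t N (box_edges d n) v).
Proof.
  intros ht [h1 h2 h3 h4]; constructor; auto.
  - simpl. apply NoDup_map_NoDup_ForallPairs; [|auto].
    intros [x i] [y j] hx hy E; unfold translate in E; simpl in E; injection E as E1 E2.
    apply in_box_edges in hx as [hx _]; apply in_box_iff in hx as [hx _].
    apply in_box_edges in hy as [hy _]; apply in_box_iff in hy as [hy _].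
    f_equal; auto. rewrite <- (vadd_opp' x t), <- (vadd_opp' y t), E1; auto; lia.
  - intros e he; apply in_map_iff in he as (e' & <- & he').
    rewrite (translated_ends d); auto.
  - intros f H i j hi hj; apply h4; auto. intros e he.
    rewrite <- (translated_ends d n t) by assumption. apply H. now apply in_map.
Qed.

Definition edge_open (e : zedge) (k : zedge -> bool) : R := if k e then 1 else 0.

Lemma lookup_map e Es (g : zedge -> bool) : In e Es -> lookup e Es (map g Es) = g e.
Proof.
  induction Es as [|a Es IH]; [easy|]; intros h; simpl.
  destruct (point_eqb_spec (fst e) (fst a)) as [E1|n1]; simpl.
  - destruct (Nat.eqb_spec (snd e) (snd a)) as [E2|n2]; simpl.
    + f_equal; destruct e, a; simpl in *; congruence.
    + destruct h as [->|h]; [easy|auto].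
  - destruct h as [->|h]; [easy|auto].
Qed.

Lemma lookup_notin e Es s : ~ In e Es -> lookup e Es s = false.
Proof.
  revert s; induction Es as [|a Es IH]; intros s h; [destruct s; auto|]; simpl in *.
  destruct s as [|b s]; auto.
  destruct (point_eqb_spec (fst e) (fst a)) as [E1|n1]; simpl; [|apply IH; tauto].
  destruct (Nat.eqb_spec (snd e) (snd a)) as [E2|n2]; simpl; [|apply IH; tauto].
  exfalso; apply h; left; destruct e, a; simpl in *; congruence.
Qed.

Lemma Ex_translated q p d n t N v e : length t = d ->
  proper (lattice_network N (box_edges d n) v) -> In e (box_edges d n) ->
  Ex zedge zedge_dec q p (translated t N (box_edges d n) v) (edge_open (translate (vopp t) e)) =
  Ex zedge zedge_dec q p (lattice_network N (box_edges d n) v) (edge_open e).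
Proof.
  intros ht pr he.
  pose proof (translated_proper d n t N v ht pr) as pr'.
  pose proof (prob_Ex zedge zedge_dec q p _ (lookup e (box_edges d n)) pr') as P1.
  pose proof (prob_Ex zedge zedge_dec q p _ (lookup e (box_edges d n)) pr) as P2.
  rewrite translated_end_list in P1 by assumption.
  change (edges (lattice_network N (box_edges d n) v)) with (box_edges d n) in P2.
  change (order (translated t N (box_edges d n) v)) with (order (lattice_network N (box_edges d n) v)) in P1.
  rewrite P1 in P2.
  etransitivity; [etransitivity; [|exact P2]|]; apply Ex_ext; intros k; unfold edge_open.
  - unfold translated; simpl edges; rewrite map_map, lookup_map by assumption; reflexivity.
  - simpl edges; now rewrite lookup_map.
Qed.

(** * A small box inside a translated large box *)

Section Embedding.
Variables (d N M r : nat) (t : point).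
Hypothesis ht : length t = d.
Hypothesis hr : bounded_by r t.
Hypothesis hM : (N + r <= M)%nat.

Lemma box_translate y : In y (box d N) -> In (vadd y t) (box d M).
Proof.
  rewrite !in_box_iff, !in_box_spec; intros [h1 h2]; split; [rewrite vadd_length; lia|].
  intros z hz; pose proof (vadd_bounded y t N r h2 hr z hz); lia.
Qed.

Lemma box_edges_translate : incl (box_edges d N) (map (translate (vopp t)) (box_edges d M)).
Proof.
  intros [y i] h; apply in_box_edges in h as (h1 & h2 & h3).
  assert (length y = d) by now apply in_box_iff in h1.
  apply in_translated_edges; auto; apply in_box_edges; repeat split; auto using box_translate.
  rewrite <- vadd_shift by lia; now apply box_translate.
Qed.

Lemma free_contracts_translated :
  contracts (fun k => pos (vadd (nth k (box d N) nil) t) (box d M))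
    (free_network d N) (translated t (free_N d M) (box_edges d M) (fun x => pos x (box d M))).
Proof.
  intros [y i] he; split; intros h; [|now destruct h; apply box_edges_translate].
  apply in_box_edges in he as (h1 & h2 & h3); simpl; now rewrite !nth_pos.
Qed.

(** Unlike [wired_index], which is meaningful only inside the box, this also sends points beyond the
    box to the wired vertex 0. *)
Definition interior_index (y : point) : nat :=
  if in_dec (list_eq_dec Z.eq_dec) y (interior d N) then S (pos y (interior d N)) else 0%nat.

Lemma interior_index_wired y : In y (box d N) -> interior_index y = wired_index d N y.
Proof.
  intros h; unfold interior_index; destruct (in_dec (list_eq_dec Z.eq_dec) y (interior d N)) as [i|n].
  - now rewrite wired_index_interior.
  - unfold wired_index; destruct (on_boundary N y) eqn:E; auto.
    exfalso; apply n, filter_In; now rewrite E.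
Qed.

Definition wired_collapse (k : nat) : nat :=
  match k with
  | O => O
  | S k' => interior_index (vadd (nth k' (interior d M) nil) (vopp t))
  end.

(** The case to check is a boundary point of the large box: since N + r <= M it cannot be a
    translate of an interior point of the small one, so 0 goes to 0 consistently. *)
Lemma wired_collapse_index y : length y = d -> In (vadd y t) (box d M) ->
  wired_collapse (wired_index d M (vadd y t)) = interior_index y.
Proof.
  intros hy h; unfold wired_index; destruct (on_boundary M (vadd y t)) eqn:E; simpl.
  - unfold interior_index; destruct (in_dec (list_eq_dec Z.eq_dec) y (interior d N)) as [i|n]; auto.
    exfalso; apply in_interior in i as [_ i]; apply on_boundary_spec in E as (z & hz & Ez).
    apply vadd_coord in hz as (a & b & h1 & h2 & ->).
    specialize (i a h1); specialize (hr b h2); lia.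
  - rewrite nth_pos by (apply filter_In; now rewrite E). rewrite vadd_opp; auto; lia.
Qed.

(** An edge with an end in the interior of the small box belongs to that box. Hence both ends of a
    discarded edge collapse to the wired vertex, and the edge becomes a loop. *)
Lemma translated_contracts_wired :
  contracts wired_collapse (translated t (wired_N d M) (box_edges d M) (wired_index d M)) (wired_network d N).
Proof.
  intros [y i] he.
  pose proof (translated_edges_length d M t y i ht he) as hy.
  apply in_translated_edges in he; auto. apply in_box_edges in he as (h1 & h2 & h3).
  rewrite <- vadd_shift in h3 by lia.
  cbn [ends translated lattice_network fst snd wired_network edges].
  rewrite !wired_collapse_index by (rewrite ?shift_length; auto).
  split; intros h.
  - apply in_box_edges in h as (g1 & g2 & g3); split; now apply interior_index_wired.
  - assert (n1 : ~ In y (interior d N)).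
    { intros g; apply h, in_box_edges; split; [now apply interior_incl|split; auto].
      apply in_interior in g as [_ g]; apply in_box_iff; rewrite shift_length, in_box_spec.
      split; auto; intros z hz; apply shift_coord in hz as [hz|hz]; apply g in hz; lia. }
    assert (n2 : ~ In (shift y i) (interior d N)).
    { intros g; apply h, in_box_edges; split; [|split; [auto|now apply interior_incl]].
      apply in_interior in g as [_ g]; apply in_box_iff; rewrite in_box_spec.
      split; auto; intros z hz; apply (shift_coord_inv y i) in hz as [hz|hz]; apply g in hz; lia. }
    unfold interior_index.
    destruct (in_dec (list_eq_dec Z.eq_dec) y (interior d N)); [easy|]; destruct (in_dec (list_eq_dec Z.eq_dec) (shift y i) (interior d N)); easy.
Qed.

End Embedding.

(** * Jump points *)

Lemma vadd_sub x y : length x = length y -> vadd x (vopp (vadd x (vopp y))) = y.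
Proof.
  revert y; induction x as [|z x IH]; intros [|w y] h; simpl in *; try easy.
  unfold vadd, vopp in *; simpl; f_equal; [lia|]; apply IH; lia.
Qed.

(** A growing configuration either looks the same on [F] or gains at least one open edge there; this
    gain compensates any change of an indicator. *)
Lemma sumL_obs_jump (F : list zedge) (g g' : zedge -> bool) :
  (forall e, g e = true -> g' e = true) ->
  map g F = map g' F /\ sumL F (fun e => if g e then 1 else 0) = sumL F (fun e => if g' e then 1 else 0) \/
  sumL F (fun e => if g e then 1 else 0) + 1 <= sumL F (fun e => if g' e then 1 else 0).
Proof.
  intros H; induction F as [|e F IH]; [now left|].
  assert (U : forall h : zedge -> bool, sumL (e :: F) (fun e => if h e then 1 else 0) =
    (if h e then 1 else 0) + sumL F (fun e => if h e then 1 else 0)) by reflexivity.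
  rewrite !U; simpl map. specialize (H e).
  destruct (g e) eqn:E, (g' e) eqn:E'; try (specialize (H eq_refl); discriminate);
    destruct IH as [[I1 I2]|I]; try (left; rewrite I1, I2; now split); right; lra.
Qed.

Lemma bounded_by_list (F : list zedge) : exists r, forall e, In e F -> bounded_by r (fst e).
Proof.
  assert (B : forall x : point, exists r, bounded_by r x).
  { induction x as [|z x [r hr]]; [exists 0%nat; now intros z|].
    exists (Z.to_nat (Z.abs z) + r)%nat; intros w [<-|hw]; [lia|]. specialize (hr w hw); lia. }
  induction F as [|e F [r hr]]; [exists 0%nat; now intros e|].
  destruct (B (fst e)) as [s hs]; exists (r + s)%nat; intros e' [<-|he] w hw.
  - specialize (hs w hw); lia.
  - specialize (hr e' he w hw); lia.
Qed.

Lemma edge_open_isotone e : isotone (edge_open e).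
Proof.
  intros k k' h; unfold edge_open; specialize (h e).
  destruct (k e); [rewrite h by auto; lra|destruct (k' e); lra].
Qed.

Lemma edge_open_nonneg e k : 0 <= edge_open e k.
Proof. unfold edge_open; destruct (k e); lra. Qed.

(** The bound n(a - b)a^(n-1) on a difference of powers, multiplied by a to avoid the exponent n -
    1. It controls the boundary of a box by its volume. *)
Lemma pow_gap (a b : R) (n : nat) : 0 <= b -> b <= a -> a * (a ^ n - b ^ n) <= INR n * (a - b) * a ^ n.
Proof.
  intros h0 h1; induction n as [|n IH]; [simpl; lra|].
  rewrite S_INR; simpl pow.
  assert (b ^ n <= a ^ n) by (apply pow_incr; lra).
  assert (a * (a * a ^ n - b * b ^ n) = a * (a * (a ^ n - b ^ n)) + a * ((a - b) * b ^ n)) by ring.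
  assert (a * (a * (a ^ n - b ^ n)) <= a * (INR n * (a - b) * a ^ n)) by (apply Rmult_le_compat_l; lra).
  assert (a * ((a - b) * b ^ n) <= a * ((a - b) * a ^ n))
    by (apply Rmult_le_compat_l; [lra|apply Rmult_le_compat_l; lra]).
  lra.
Qed.

(** * Free and wired expectations in boxes *)

Section Comparison.
Variables (d : nat) (q : R).
Hypothesis hd : (2 <= d)%nat.
Hypothesis hq : 1 <= q.

Definition free_mean (p : R) (n : nat) := Ex zedge zedge_dec q p (free_network d n).
Definition wired_mean (p : R) (n : nat) := Ex zedge zedge_dec q p (wired_network d n).

Lemma wired_network_proper n : proper (wired_network d n).
Proof. apply wired_proper; lia. Qed.

Lemma free_le_wired p n F : 0 < p < 1 -> (forall k, 0 <= F k) -> isotone F ->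
  free_mean p n F <= wired_mean p n F.
Proof.
  intros hp F0 Fi.
  apply (domination _ zedge_dec q hq p _ _ _ F hp (free_proper d n) (wired_network_proper n) (free_contracts_wired d n)); auto.
  left; apply incl_refl.
Qed.

Definition edge_gap (p : R) (n : nat) (e : zedge) : R :=
  wired_mean p n (edge_open e) - free_mean p n (edge_open e).

Lemma edge_gap_nonneg p n e : 0 < p < 1 -> 0 <= edge_gap p n e.
Proof.
  intros hp; pose proof (free_le_wired p n (edge_open e) hp (edge_open_nonneg e) (edge_open_isotone e)).
  unfold edge_gap; lra.
Qed.

(** Moving the large box by y - x makes the two edges coincide, and N + r <= M puts the small box
    inside it. Growth of the box raises free and lowers wired probabilities. *)
Lemma edge_gap_decreases p N M r x y i : 0 < p < 1 ->
  In (x, i) (box_edges d M) -> In (y, i) (box_edges d N) ->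
  bounded_by r (vadd x (vopp y)) -> (N + r <= M)%nat ->
  edge_gap p M (x, i) <= edge_gap p N (y, i).
Proof.
  intros hp hx hy hr hM.
  assert (lx : length x = d) by (apply in_box_edges in hx as [h _]; now apply in_box_iff in h).
  assert (ly : length y = d) by (apply in_box_edges in hy as [h _]; now apply in_box_iff in h).
  set (t := vadd x (vopp y)) in *.
  assert (ht : length t = d) by (unfold t; rewrite vadd_length; rewrite vopp_length; lia).
  assert (Et : translate (vopp t) (x, i) = (y, i)).
  { unfold translate, t; simpl; f_equal; apply vadd_sub; lia. }
  assert (pf := free_proper d M). assert (pw := wired_network_proper M).
  assert (A : free_mean p N (edge_open (y, i)) <= free_mean p M (edge_open (x, i))).
  { unfold free_mean, free_network at 2.
    rewrite <- (Ex_translated q p d M t _ _ (x, i) ht pf hx), Et.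
    apply (domination _ zedge_dec q hq p _ _ _ _ hp (free_proper d N) (translated_proper _ _ _ _ _ ht pf)
      (free_contracts_translated d N M r t ht hr hM)); auto using edge_open_nonneg, edge_open_isotone.
    left; exact (box_edges_translate d N M r t ht hr hM). }
  assert (B : wired_mean p M (edge_open (x, i)) <= wired_mean p N (edge_open (y, i))).
  { unfold wired_mean, wired_network at 1.
    rewrite <- (Ex_translated q p d M t _ _ (x, i) ht pw hx), Et.
    apply (domination _ zedge_dec q hq p _ _ _ _ hp (translated_proper _ _ _ _ _ ht pw) (wired_network_proper N)
      (translated_contracts_wired d N M r t ht hr hM)); auto using edge_open_nonneg, edge_open_isotone.
    right; split; [exact (box_edges_translate d N M r t ht hr hM)|].
    intros k k' h; unfold edge_open; now rewrite (h (y, i) hy). }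
  unfold edge_gap; lra.
Qed.

(** The configuration as a finite-volume event reads it: edges outside the box count as closed. *)
Definition observed (n : nat) (k : zedge -> bool) (e : zedge) : bool :=
  lookup e (box_edges d n) (map k (box_edges d n)).

Lemma observed_eq n k e :
  observed n k e = if in_dec zedge_dec e (box_edges d n) then k e else false.
Proof.
  unfold observed; destruct (in_dec zedge_dec e (box_edges d n)).
  - now apply lookup_map.
  - now apply lookup_notin.
Qed.

Definition event_indicator (n : nat) (F : list zedge) (A : list bool -> bool) (k : zedge -> bool) : R :=
  if A (map (observed n k) F) then 1 else 0.

Lemma P_free_mean p F A n : P_free d q p F A n = free_mean p n (event_indicator n F A).
Proof. exact (prob_Ex _ zedge_dec q p _ (restrict_event d n F A) (free_proper d n)). Qed.

Lemma P_wired_mean p F A n : P_wired d q p F A n = wired_mean p n (event_indicator n F A).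
Proof. exact (prob_Ex _ zedge_dec q p _ (restrict_event d n F A) (wired_network_proper n)). Qed.

Definition observed_gap (p : R) (n : nat) (e : zedge) : R :=
  if in_dec zedge_dec e (box_edges d n) then edge_gap p n e else 0.

(* Flipping an observed edge changes the indicator by at most 1, so adding the number of open observed edges makes both it and its complement increasing. *)
Lemma event_gap p F A n : 0 < p < 1 ->
  Rabs (P_wired d q p F A n - P_free d q p F A n) <= sumL F (observed_gap p n).
Proof.
  intros hp; rewrite P_free_mean, P_wired_mean.
  set (a := event_indicator n F A).
  set (S := fun k => sumL F (fun e => if observed n k e then 1 else 0)).
  pose proof (free_proper d n) as pf; pose proof (wired_network_proper n) as pw.
  assert (a01 : forall k, 0 <= a k <= 1) by (intros k; unfold a, event_indicator; destruct (A _); lra).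
  assert (S0 : forall k, 0 <= S k) by (intros k; apply sumL_nonneg; intros e _; destruct (observed n k e); lra).
  assert (J : forall k k', below k k' -> a k = a k' /\ S k = S k' \/ S k + 1 <= S k').
  { intros k k' h. destruct (sumL_obs_jump F (observed n k) (observed n k')) as [[h1 h2]|h1].
    - intros e; rewrite !observed_eq; destruct (in_dec _ _ _); auto.
    - left; split; [|exact h2]. unfold a, event_indicator; now rewrite h1.
    - right; exact h1. }
  assert (Sgap : wired_mean p n S - free_mean p n S = sumL F (observed_gap p n)).
  { unfold wired_mean, free_mean, S; rewrite !Ex_sum by assumption.
    replace (sumL F (observed_gap p n)) with
      (sumL F (fun e => wired_mean p n (fun k => if observed n k e then 1 else 0)
        + (-1) * free_mean p n (fun k => if observed n k e then 1 else 0))).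
    - rewrite sumL_plus, sumL_scal; unfold wired_mean, free_mean; ring.
    - apply sumL_ext; intros e _; unfold observed_gap; destruct (in_dec zedge_dec e (box_edges d n)) as [i|ni].
      + assert (E : forall k, (if observed n k e then 1 else 0) = edge_open e k).
        { intros k; rewrite observed_eq; destruct (in_dec _ _ _); easy. }
        unfold edge_gap, wired_mean, free_mean.
        rewrite (Ex_ext _ zedge_dec q p _ _ _ E), (Ex_ext _ zedge_dec q p _ _ _ E); ring.
      + assert (E : forall k, (if observed n k e then 1 else 0) = 0).
        { intros k; rewrite observed_eq; destruct (in_dec _ _ _); easy. }
        unfold wired_mean, free_mean.
        rewrite (Ex_ext _ zedge_dec q p _ _ _ E), (Ex_ext _ zedge_dec q p _ _ _ E).
        rewrite !Ex_const by assumption; ring. }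
  assert (G1 : free_mean p n (fun k => S k + a k) <= wired_mean p n (fun k => S k + a k)).
  { apply free_le_wired; auto.
    - intros k; specialize (S0 k); specialize (a01 k); lra.
    - intros k k' h; pose proof (a01 k); pose proof (a01 k'); destruct (J k k' h) as [[-> ->]|]; lra. }
  assert (G2 : free_mean p n (fun k => S k + (1 + (-1) * a k)) <= wired_mean p n (fun k => S k + (1 + (-1) * a k))).
  { apply free_le_wired; auto.
    - intros k; specialize (S0 k); specialize (a01 k); lra.
    - intros k k' h; pose proof (a01 k); pose proof (a01 k'); destruct (J k k' h) as [[-> ->]|]; lra. }
  unfold free_mean, wired_mean in *.
  rewrite !Ex_plus in G1, G2. rewrite !Ex_plus, !Ex_scal, !Ex_const in G2 by assumption.
  apply Rabs_le; lra.
Qed.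

(** * Jumps of the edge density *)

(** An expected total number of open edges, not divided by the volume. *)
Definition free_density (p : R) (n : nat) : R := free_mean p n (open_count zedge (free_network d n)).
Definition wired_density (p : R) (n : nat) : R := wired_mean p n (open_count zedge (wired_network d n)).

Lemma density_diff p n : 0 < p < 1 ->
  wired_density p n - free_density p n = sumL (box_edges d n) (edge_gap p n).
Proof.
  intros hp; unfold wired_density, free_density, wired_mean, free_mean, open_count.
  pose proof (free_proper d n) as pf; pose proof (wired_network_proper n) as pw.
  rewrite !Ex_sum by assumption; simpl edges.
  replace (sumL (box_edges d n) (edge_gap p n)) with
    (sumL (box_edges d n) (fun e => wired_mean p n (edge_open e) + (-1) * free_mean p n (edge_open e))).
  - rewrite sumL_plus, sumL_scal; unfold wired_mean, free_mean, edge_open; ring.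
  - apply sumL_ext; intros e _; unfold edge_gap; ring.
Qed.

Lemma interior_edge N y x i M : In (x, i) (box_edges d M) -> In y (interior d N) -> In (y, i) (box_edges d N).
Proof.
  intros hx hy; apply in_box_edges in hx as (_ & hi & _); apply in_box_edges.
  split; [now apply interior_incl|split; auto].
  apply in_interior in hy as [h1 h2]; apply in_box_iff; rewrite shift_length, in_box_spec; split; auto.
  intros z hz; apply shift_coord in hz as [hz|hz]; apply h2 in hz; lia.
Qed.

(** Required in all large boxes instead of in the limit, so that finitely many jump points can be
    tested in one box. Volume is counted by interior points because every edge based there belongs
    to the box. *)
Definition jump_point (c p : R) : Prop :=
  0 < p < 1 /\ exists N0, forall N, (N0 <= N)%nat ->
    c * INR (length (interior d N)) <= wired_density p N - free_density p N.

(** Distinct limits keep the gaps over [F] summing to at least eta in every large box. For each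
    interior point y of a smaller box, every edge of [F] is compared with the edge of the same
    direction based at y, whose gap is at least as large. Summed over y, each edge of [F] accounts
    for at most the total gap of the box, whence c = eta / |F|. *)
Lemma mu_differ_jump p : 0 < p < 1 -> mu_differ d q p -> exists c, 0 < c /\ jump_point c p.
Proof.
  intros hp (F & A & l0 & l1 & c0 & c1 & hl).
  set (eta := Rabs (l1 - l0) / 2).
  assert (eta0 : 0 < eta) by (unfold eta; pose proof (Rabs_pos_lt (l1 - l0)); lra).
  destruct (c0 (eta / 2)) as [n0 h0]; [lra|]. destruct (c1 (eta / 2)) as [n1 h1]; [lra|].
  assert (low : forall n, (n0 + n1 <= n)%nat -> eta <= sumL F (observed_gap p n)).
  { intros n hn. specialize (h0 n ltac:(lia)); specialize (h1 n ltac:(lia)).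
    unfold R_dist in h0, h1. pose proof (event_gap p F A n hp) as hg.
    set (u := P_wired d q p F A n) in *; set (v := P_free d q p F A n) in *.
    assert (T : Rabs (l1 - l0) <= Rabs (u - l1) + Rabs (u - v) + Rabs (v - l0)).
    { replace (l1 - l0) with (- (u - l1) + (u - v) + (v - l0)) by ring.
      eapply Rle_trans; [apply Rabs_triang|]. apply Rplus_le_compat_r.
      eapply Rle_trans; [apply Rabs_triang|]. rewrite Rabs_Ropp; lra. }
    unfold eta in *; lra. }
  destruct (bounded_by_list F) as [r hr].
  assert (main : forall N, (n0 + n1 <= N)%nat ->
    eta * INR (length (interior d N)) <= INR (length F) * (wired_density p N - free_density p N)).
  (* A base point of [F] and a point y of the box differ by at most r + N in each coordinate, and N
     + (r + N) = M. *)
  { intros N hN. set (M := (2 * N + r)%nat).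
    rewrite <- sumL_const, density_diff by assumption.
    apply Rle_trans with (sumL (interior d N) (fun y => sumL F (fun e => observed_gap p N (y, snd e)))).
    - apply sumL_le; intros y hy. eapply Rle_trans; [apply (low M); unfold M; lia|].
      apply sumL_le; intros [x i] he; unfold observed_gap; simpl.
      destruct (in_dec zedge_dec (x, i) (box_edges d M)) as [hx|hx].
      + pose proof (interior_edge N y x i M hx hy) as hy'.
        destruct (in_dec zedge_dec (y, i) (box_edges d N)) as [_|n]; [|easy].
        apply (edge_gap_decreases p N M (r + N)); auto; [|unfold M; lia].
        apply vadd_bounded; [exact (hr (x, i) he)|apply vopp_bounded].
        intros z hz; apply in_interior in hy as [_ hy]; apply hy in hz; lia.
      + destruct (in_dec zedge_dec (y, i) (box_edges d N)); [now apply edge_gap_nonneg|lra].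
    - rewrite sumL_exchange, Rmult_comm, <- sumL_const. apply sumL_le; intros [x i] _; simpl.
      replace (sumL (interior d N) (fun y => observed_gap p N (y, i)))
        with (sumL (map (fun y => (y, i)) (interior d N)) (observed_gap p N))
        by (unfold sumL; now rewrite map_map).
      apply sumL_incl.
      + apply FinFun.Injective_map_NoDup; [intros a b; congruence|apply interior_nodup].
      + intros e _; unfold observed_gap; destruct (in_dec zedge_dec e (box_edges d N)).
        * right; split; [assumption|lra].
        * left; lra.
      + intros; now apply edge_gap_nonneg. }
  destruct F as [|e F].
  - specialize (low (n0 + n1)%nat (le_n _)); unfold sumL in low; simpl in low; lra.
  - assert (L : 0 < INR (length (e :: F))) by (apply lt_0_INR; simpl; lia).
    exists (eta / INR (length (e :: F))); split; [now apply Rdiv_lt_0_compat|].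
    split; auto; exists (n0 + n1)%nat; intros N hN; specialize (main N hN).
    apply (Rmult_le_reg_l (INR (length (e :: F)))); auto.
    replace (INR (length (e :: F)) * (eta / INR (length (e :: F)) * INR (length (interior d N))))
      with (eta * INR (length (interior d N))) by (field; lra). exact main.
Qed.

Definition boundary_size (N : nat) : R := INR (length (box d N)) - INR (length (interior d N)).

Lemma boundary_size_ge N : INR (order (free_network d N) - order (wired_network d N)) <= boundary_size N.
Proof.
  unfold boundary_size; simpl; unfold free_N, wired_N.
  assert (h : (length (interior d N) <= length (box d N))%nat) by apply filter_length_le.
  rewrite <- minus_INR by assumption. apply le_INR; lia.
Qed.

Lemma wired_order_le N : (order (wired_network d N) <= order (free_network d N))%nat.
Proof.
  simpl; unfold free_N, wired_N.
  destruct N as [|N].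
  - replace (length (interior d 0)) with 0%nat.
    + rewrite box_length; apply Nat.neq_0_lt_0, Nat.pow_nonzero; lia.
    + destruct (interior d 0) as [|x l] eqn:E; auto. exfalso.
      assert (h : In x (interior d 0)) by (rewrite E; simpl; auto).
      apply in_interior in h as [h1 h2]. destruct x as [|z x]; [simpl in h1; lia|].
      specialize (h2 z (or_introl eq_refl)); lia.
  - rewrite interior_length, !box_length. apply Nat.pow_lt_mono_l; lia.
Qed.

Lemma density_step p p' N : 0 < p -> p < p' -> p' < 1 ->
  wired_density p N <= free_density p' N + ln q / 2 / log_odds_ratio p p' * boundary_size N.
Proof.
  intros h0 h h1.
  pose proof (density_gap _ zedge_dec q hq _ _ _ p p' (free_proper d N) (wired_network_proper N)
    (free_contracts_wired d N) eq_refl (wired_order_le N) h0 h h1) as G.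
  change (Ex zedge zedge_dec q p (wired_network d N) (open_count zedge (wired_network d N)))
    with (wired_density p N) in G.
  change (Ex zedge zedge_dec q p' (free_network d N) (open_count zedge (free_network d N)))
    with (free_density p' N) in G.
  pose proof (log_odds_ratio_pos p p' h0 h h1) as hl. set (l := log_odds_ratio p p') in *.
  assert (lq : 0 <= ln q / 2).
  { destruct (Req_dec q 1) as [->|]; [rewrite ln_1; lra|].
    assert (0 < ln q) by (rewrite <- ln_1; apply ln_increasing; lra). lra. }
  pose proof (Rmult_le_compat_r (ln q / 2) _ _ lq (boundary_size_ge N)) as Bd.
  assert (I : wired_density p N - free_density p' N <= ln q / 2 / l * boundary_size N); [|lra].
  apply (Rmult_le_reg_l l); auto.
  replace (l * (ln q / 2 / l * boundary_size N)) with (boundary_size N * (ln q / 2)) by (field; lra).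
  lra.
Qed.

Lemma free_density_bounds p N : 0 < p < 1 -> 0 <= free_density p N <= INR (length (box_edges d N)).
Proof.
  intros hp; pose proof (free_proper d N) as pf.
  unfold free_density, free_mean, open_count; simpl edges; split.
  - rewrite <- (Ex_const zedge zedge_dec q hq p _ 0 hp pf) at 1.
    apply Ex_le; auto; intros k; apply sumL_nonneg; intros e _; destruct (k e); lra.
  - rewrite <- (Ex_const zedge zedge_dec q hq p _ (INR (length (box_edges d N))) hp pf).
    apply Ex_le; auto; intros k.
    rewrite <- (Rmult_1_l (INR _)), <- sumL_const; apply sumL_le; intros e _; destruct (k e); lra.
Qed.

(* Along a chain of jump points the free density telescopes, since the wired density at one point is at most the free density at the next up to a boundary term. *)
Lemma jump_chain c p L : StronglySorted Rlt (p :: L) -> Forall (jump_point c) (p :: L) ->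
  exists C N0, forall N, (N0 <= N)%nat ->
    free_density p N + c * INR (length (interior d N)) * INR (length L) <=
    INR (length (box_edges d N)) + C * boundary_size N.
Proof.
  revert p; induction L as [|p' L IH]; intros p hs hf.
  - inversion hf as [|? ? [hp _] _]; subst.
    exists 0, 0%nat; intros N _; pose proof (free_density_bounds p N hp); simpl; lra.
  - apply StronglySorted_inv in hs as [hs hlt]. inversion hlt as [|? ? hpp _]; subst.
    inversion hf as [|? ? [hp [N1 h1]] hf']; subst. inversion hf' as [|? ? [hp' _] _]; subst.
    destruct (IH p' hs hf') as (C & N0 & H).
    (* One boundary constant is added per step; the total depends on the chain but not on the
       box. *)
    exists (C + ln q / 2 / log_odds_ratio p p'), (N0 + N1)%nat; intros N hN.
    specialize (H N ltac:(lia)); specialize (h1 N ltac:(lia)).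
    pose proof (density_step p p' N (proj1 hp) hpp (proj2 hp')).
    change (length (p' :: L)) with (S (length L)); rewrite S_INR; lra.
Qed.

Lemma box_INR n : INR (length (box d n)) = (2 * INR n + 1) ^ d.
Proof. rewrite box_length, pow_INR, plus_INR, mult_INR; reflexivity. Qed.

(** Let V and I be the volumes of a box and of its interior. For large boxes I >= V/2 and the
    boundary error is at most V, while there are at most d V edges; so c (V/2) |L| <= (d + 1) V. *)
Lemma jump_chain_length c p L : 0 < c -> StronglySorted Rlt (p :: L) ->
  Forall (jump_point c) (p :: L) -> INR (length L) <= 2 * (INR d + 1) / c.
Proof.
  intros hc hs hf. destruct (jump_chain c p L hs hf) as (C & N0 & H).
  inversion hf as [|? ? [hp _] _]; subst.
  (* For side length a, [pow_gap] gives a(V - I) <= 2 d V. The choice makes a at least 4d, for V - I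
     <= V/2, and at least 2d|C|, for C(V - I) <= V. *)
  destruct (INR_unbounded (2 * INR d + INR d * Rabs C)) as [n1 hn1].
  set (n := (N0 + n1)%nat). specialize (H (S n) ltac:(unfold n; lia)).
  pose proof (free_density_bounds p (S n) hp) as [f0 _].
  unfold boundary_size in H; rewrite interior_length, !box_INR in H.
  pose proof (le_INR _ _ (box_edges_length d (S n))) as E; rewrite mult_INR, box_INR in E.
  rewrite S_INR in H, E.
  set (b := 2 * INR n + 1) in *. replace (2 * (INR n + 1) + 1) with (b + 2) in * by (unfold b; ring).
  assert (nn : INR n1 <= INR n) by (apply le_INR; unfold n; lia).
  pose proof (pos_INR n); pose proof (pos_INR n1).
  assert (b1 : 1 <= b) by (unfold b; lra).
  pose proof (pow_gap (b + 2) b d ltac:(lra) ltac:(lra)) as G.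
  replace (b + 2 - b) with 2 in G by ring.
  set (a := b + 2) in *. set (V := a ^ d) in *. set (I := b ^ d) in *.
  assert (V0 : 0 < V) by (apply pow_lt; unfold a; lra).
  assert (IV : I <= V) by (apply pow_incr; unfold a; lra).
  pose proof (pos_INR d) as d0.
  assert (a1 : 2 * (2 * INR d + INR d * Rabs C) <= a) by (unfold a, b; lra).
  pose proof (Rabs_pos C) as C0. pose proof (Rmult_le_pos _ _ d0 C0) as dC0.
  assert (VI : V - I <= V / 2).
  { apply (Rmult_le_reg_l a); [unfold a; lra|].
    assert (4 * INR d * V <= a * V) by (apply Rmult_le_compat_r; lra). lra. }
  assert (CV : C * (V - I) <= V).
  { apply Rle_trans with (Rabs C * (V - I)); [apply Rmult_le_compat_r; [lra|apply Rle_abs]|].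
    apply (Rmult_le_reg_l a); [unfold a; lra|].
    assert (Rabs C * (a * (V - I)) <= Rabs C * (INR d * 2 * V)) by (apply Rmult_le_compat_l; lra).
    assert (2 * (INR d * Rabs C) * V <= a * V) by (apply Rmult_le_compat_r; lra). lra. }
  assert (c * (V / 2) * INR (length L) <= c * I * INR (length L)).
  { apply Rmult_le_compat_r; [apply pos_INR|]. apply Rmult_le_compat_l; lra. }
  apply (Rmult_le_reg_l (c * (V / 2))); [apply Rmult_lt_0_compat; lra|].
  replace (c * (V / 2) * (2 * (INR d + 1) / c)) with ((INR d + 1) * V) by (field; lra).
  lra.
Qed.

End Comparison.

(** * From bounded chains to countability *)

Lemma sorted_insert (x : R) L : StronglySorted Rlt L -> ~ In x L ->
  exists L', StronglySorted Rlt L' /\ Permutation (x :: L) L'.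
Proof.
  induction L as [|y L IH]; intros hs hx.
  - exists (x :: nil); split; [repeat constructor|apply Permutation_refl].
  - apply StronglySorted_inv in hs as [hs hy].
    destruct (Rlt_le_dec x y) as [h|h].
    + exists (x :: y :: L); split; [|apply Permutation_refl].
      constructor; [now constructor|]. constructor; auto.
      eapply Forall_impl; [|exact hy]; simpl; intros; lra.
    + destruct IH as (L' & s' & P); auto; [simpl in hx; tauto|].
      exists (y :: L'); split.
      * constructor; auto. eapply Permutation_Forall; [exact P|]. constructor; auto.
        destruct h as [h|h]; auto. simpl in hx; intuition congruence.
      * eapply perm_trans; [apply perm_swap|now apply perm_skip].
Qed.

(** As long as a sorted list misses a point of [P], that point can be inserted; the length bound
    stops this. The number j counts the insertions left before the bound would be exceeded. *)
Lemma finite_of_bounded_chains (P : R -> Prop) (K : nat) :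
  (forall L, StronglySorted Rlt L -> Forall P L -> (length L <= K)%nat) ->
  exists L, forall p, P p -> In p L.
Proof.
  intros H.
  assert (G : forall j L, StronglySorted Rlt L -> Forall P L -> (K < length L + j)%nat ->
    exists L, forall p, P p -> In p L).
  { induction j as [|j IH]; intros L hs hf hj; [specialize (H L hs hf); lia|].
    destruct (classic (forall p, P p -> In p L)) as [h|h]; [eauto|].
    apply not_all_ex_not in h as [p h]; apply imply_to_and in h as [h1 h2].
    destruct (sorted_insert p L hs h2) as (L' & s' & perm).
    apply (IH L' s').
    - eapply Permutation_Forall; [exact perm|now constructor].
    - apply Permutation_length in perm; simpl in perm; lia. }
  apply (G (S K) nil); [constructor|constructor|simpl; lia].
Qed.

(** Choice selects one list for each m, and Cantor pairing enumerates all positions. The default 0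
    past the end of a list only adds a value to the range, which the conclusion allows. *)
Lemma countable_union_of_finite (P : nat -> R -> Prop) :
  (forall m, exists L, forall p, P m p -> In p L) ->
  exists f : nat -> R, forall m p, P m p -> exists k, f k = p.
Proof.
  intros H.
  set (g := fun m => proj1_sig (constructive_indefinite_description _ (H m))).
  assert (hg : forall m p, P m p -> In p (g m)).
  { intros m; unfold g; now destruct (constructive_indefinite_description _ (H m)). }
  exists (fun k => nth (snd (Cantor.of_nat k)) (g (fst (Cantor.of_nat k))) 0).
  intros m p h; destruct (In_nth _ _ 0 (hg m p h)) as (j & _ & hj).
  exists (Cantor.to_nat (m, j)); now rewrite Cantor.cancel_of_to.
Qed.

Theorem theorem5p1 (d : nat) (q : R) (hd : (2 <= d)%nat) (hq : 1 <= q) :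
  exists f : nat -> R,
    forall p : R, 0 <= p <= 1 -> mu_differ d q p -> exists k : nat, f k = p.
Proof.
  destruct (countable_union_of_finite (fun m p => jump_point d q (/ INR (S m)) p)) as [f hf].
  - intros m.
    assert (c0 : 0 < / INR (S m)) by (apply Rinv_0_lt_compat, lt_0_INR; lia).
    destruct (INR_unbounded (2 * (INR d + 1) / / INR (S m))) as [K hK].
    (* The chain bound counts the points after the first, hence the successor. *)
    apply (finite_of_bounded_chains _ (S K)).
    intros [|p L] hs hfL; simpl; [lia|].
    pose proof (jump_chain_length d q hd hq _ p L c0 hs hfL).
    apply le_n_S, INR_le; lra.
  (* The values 0 and 1 take the first two places: the argument needs positive weights and finite
     log-odds. *)
  - exists (fun k => match k with O => 0 | S O => 1 | S (S k') => f k' end).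
    intros p hp hmu.
    destruct (Req_dec p 0) as [->|n0]; [now exists 0%nat|].
    destruct (Req_dec p 1) as [->|n1]; [now exists 1%nat|].
    destruct (mu_differ_jump d q hd hq p) as (c & c0 & hp' & N0 & hN); auto; [lra|].
    (* A jump of size c is also one of size 1/m for some m with 1/m < c; the family is indexed so
       that 1/m belongs to the predecessor of m. *)
    destruct (archimed_cor1 c c0) as (m & hm & m0).
    destruct (hf (pred m) p) as [k hk].
    + split; auto; exists N0; intros N h; eapply Rle_trans; [|now apply hN].
      apply Rmult_le_compat_r; [apply pos_INR|]. rewrite Nat.succ_pred by lia; lra.
    + now exists (S (S k)).
Qed.
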